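(* Let $\mathbf{S}=(S_{\boldsymbol{\alpha}})_{\boldsymbol{\alpha}}$ be an optimal solution of the $r$-th order correlative sparsity adapted moment relaxation (with optimal value $\lambda_r^{(\mathrm{cs})}$), $r\ge r_{\min}$, of the polynomial matrix optimization problem with optimal value $\lambda^\star$. Assume: (i) $\mathrm{rank}\,S_{\mathbf{0}}=1$; (ii) for each $\ell\in[t]$, $\mathrm{rank}\,M_r(\mathbf{S},\mathcal{I}_\ell)=\mathrm{rank}\,M_{r-d_{\mathbf{K}_\ell}}(\mathbf{S},\mathcal{I}_\ell)=:s_\ell$; (iii) for all pairs $\{i,j\}$ (of distinct indices in $[t]$) with $\mathcal{I}_i\cap\mathcal{I}_j\neq\emptyset$, $\mathrm{rank}\,M_r(\mathbf{S},\mathcal{I}_i\cap\mathcal{I}_j)=1$. Then $\lambda_r^{(\mathrm{cs})}=\lambda^\star$. Moreover, let $\Delta_\ell=\{\boldsymbol{x}^i(\ell)\}_{i=1}^{s_\ell}$ be the set of points obtained by applying the extraction procedure to the moment matrix $M_r(\mathbf{S},\mathcal{I}_\ell)$, $\ell\in[t]$, and let $S_{\mathbf{0}}=\boldsymbol{v}\boldsymbol{v}^{\intercal}$ for some $\boldsymbol{v}\in\mathbb{R}^p$. Then each point $\hat{\boldsymbol{x}}\in\mathbb{R}^n$ satisfying, for every $\ell\in[t]$, $\hat{\boldsymbol{x}}(\ell):=(\hat x_i)_{i\in\mathcal{I}_\ell}=\boldsymbol{x}^{i_\ell}(\ell)$ for some $\boldsymbol{x}^{i_\ell}(\ell)\in\Delta_\ell$,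 is an optimal solution of the polynomial matrix optimization problem, and $\boldsymbol{v}$ is the corresponding eigenvector (i.e. $F(\hat{\boldsymbol{x}})\boldsymbol{v}=\lambda^\star\boldsymbol{v}$).
   Context: **Problem.** $\lambda^\star:=\inf_{\boldsymbol{x}\in\mathbb{R}^n}\lambda_{\min}(F(\boldsymbol{x}))$ s.t. $G_1(\boldsymbol{x})\succeq0,\ldots,G_m(\boldsymbol{x})\succeq0$, where $F$ is a symmetric $p\times p$ real polynomial matrix, $G_k$ a symmetric $q_k\times q_k$ real polynomial matrix, and $\lambda_{\min}$ is the smallest eigenvalue. An optimal solution is a feasible point $\boldsymbol{x}$ with $\lambda_{\min}(F(\boldsymbol{x}))=\lambda^\star$. Set $d_k=\lceil\deg G_k/2\rceil$ (degree = maximum degree of entries), $r_{\min}=\max\{\lceil\deg F/2\rceil,d_1,\ldots,d_m\}$, $[t]=\{1,\ldots,t\}$, $|\boldsymbol{\alpha}|=\sum_i\alpha_i$, $\mathbb{N}^n_d=\{\boldsymbol{\alpha}\in\mathbb{N}^n:|\boldsymbol{\alpha}|\le d\}$. For a multi-index, $\mathrm{supp}(\boldsymbol{\alpha})=\{k:\alpha_k\ne0\}$. Write $F=\sum_{\boldsymbol{\alpha}}F_{\boldsymbol{\alpha}}\boldsymbol{x}^{\boldsymbol{\alpha}}$, $G_k=\sum_{\boldsymbol{\gamma}}(G_k)_{\boldsymbol{\gamma}}\boldsymbol{x}^{\boldsymbol{\gamma}}$ with matrix coefficients. **Correlative sparsity.** The correlative sparsity pattern graph has vertex set $[n]$; $i,j$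 are adjacent if $i,j\in\mathrm{supp}(\boldsymbol{\alpha})$ for some $\boldsymbol{\alpha}$ with $F_{\boldsymbol{\alpha}}\neq0$, or if $x_i,x_j$ both effectively occur in some $G_k$. $\mathcal{I}_1,\ldots,\mathcal{I}_t$ are its maximal cliques. $\mathcal{J}_1,\ldots,\mathcal{J}_t$ are pairwise disjoint subsets of $[m]$ with union $[m]$ such that for $k\in\mathcal{J}_\ell$ all variables of $G_k$ have index in $\mathcal{I}_\ell$. $\mathbf{K}_\ell=\{\boldsymbol{x}(\ell)=(x_i)_{i\in\mathcal{I}_\ell}\in\mathbb{R}^{|\mathcal{I}_\ell|}: G_k(\boldsymbol{x})\succeq0\ \forall k\in\mathcal{J}_\ell\}$ and $d_{\mathbf{K}_\ell}=\max_{j\in\mathcal{J}_\ell}\lceil\deg G_j/2\rceil$. **Relaxation.** For $\mathbf{S}=(S_{\boldsymbol{\alpha}})_{\boldsymbol{\alpha}\in\mathbb{N}^n_{2r}}$ with $S_{\boldsymbol{\alpha}}$ real symmetric $p\times p$, $\mathscr{L}_{\mathbf{S}}(F)=\sum_{\boldsymbol{\alpha}}\mathrm{tr}(F_{\boldsymbol{\alpha}}S_{\boldsymbol{\alpha}})$. For $\mathcal{I}\subseteq[n]$, $M_d(\mathbf{S},\mathcal{I})$ is the block matrix with blocks indexed by $\boldsymbol{\alpha},\boldsymbol{\beta}\in\mathbb{N}^n_d$ with supports in $\mathcal{I}$, whose $(\boldsymbol{\alpha},\boldsymbol{\beta})$ block is $S_{\boldsymbol{\alpha}+\boldsymbol{\beta}}$;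 $M_d(G\mathbf{S},\mathcal{I})$ is the analogous block matrix with blocks $\sum_{\boldsymbol{\gamma}}S_{\boldsymbol{\alpha}+\boldsymbol{\beta}+\boldsymbol{\gamma}}\otimes G_{\boldsymbol{\gamma}}$. The $r$-th order relaxation is $$\lambda_r^{(\mathrm{cs})}:=\inf_{\mathbf{S}}\ \mathscr{L}_{\mathbf{S}}(F)\ \text{ s.t. } M_r(\mathbf{S},\mathcal{I}_\ell)\succeq0\ (\ell\in[t]),\ M_{r-d_k}(G_k\mathbf{S},\mathcal{I}_\ell)\succeq0\ (k\in\mathcal{J}_\ell,\ \ell\in[t]),\ \mathscr{L}_{\mathbf{S}}(I_p)=1.$$ **Extraction procedure.** A finitely atomic positive semidefinite (PSD) matrix-valued measure $\Phi=\sum_iW_i\delta_{\boldsymbol{x}^i}$ ($W_i$ PSD $p\times p$, $\boldsymbol{x}^i$ distinct points, $\delta$ the Dirac measure) represents $\mathbf{S}^\ell=(S_{\boldsymbol{\alpha}})_{|\boldsymbol{\alpha}|\le2r,\ \mathrm{supp}(\boldsymbol{\alpha})\subseteq\mathcal{I}_\ell}$ if $S_{\boldsymbol{\alpha}}=\sum_iW_i(\boldsymbol{x}^i)^{\boldsymbol{\alpha}}$ for all such $\boldsymbol{\alpha}$. The extraction procedure (of Guo and Wang, for matrix-valued moments) applied to $M_r(\mathbf{S},\mathcal{I}_\ell)$ returns the atoms $\boldsymbol{x}^1(\ell),\ldots,\boldsymbol{x}^{s_\ell}(\ell)\in\mathbf{K}_\ell$ of an $s_\ell$-atomic representing measure $\Phi_\ell=\sum_{i=1}^{s_\ell}W_{i\ell}\delta_{\boldsymbol{x}^i(\ell)}$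 of $\mathbf{S}^\ell$ with $W_{i\ell}$ PSD and $\sum_i\mathrm{rank}\,W_{i\ell}=\mathrm{rank}\,M_r(\mathbf{S},\mathcal{I}_\ell)$.
   Formalization: Here d_{K_ℓ} is max{1, max_{j∈J_ℓ}⌈deg G_j/2⌉}; this differs from the printed formula only if J_ℓ is empty or its G_j are all constant, where (ii) would be void and the claim false (e.g. an unconstrained perturbed Motzkin polynomial). *)

(* Defs.v *)
(* [mpoly] has to be imported before the mathcomp-analysis
   files: in the other order their notations clash. *)
From HB Require Import structures.
From mathcomp Require Import all_boot all_order all_algebra.
From mathcomp Require Import mpoly mxtens.
From mathcomp Require Import classical_sets reals constructive_ereal ereal.

Set Implicit Arguments.
Unset Strict Implicit.
Unset Printing Implicit Defensive.

Import Order.TTheory GRing.Theory Num.Theory.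
Local Open Scope ring_scope.

Section PolynomialMatrices.
Context {R : realType} {n : nat}.

Definition psd p (A : 'M[R]_p) : Prop :=
  A^T = A /\ forall v : 'cV[R]_p, 0 <= (v^T *m A *m v) 0 0.

(* Meant for symmetric A with p > 0, where the set is finite and nonempty. *)
Definition lambda_min p (A : 'M[R]_p) : R :=
  inf [set a | eigenvalue A a]%classic.

Definition eval_mx p (P : 'M[{mpoly R[n]}]_p) (x : 'rV[R]_n) : 'M[R]_p :=
  map_mx (meval (x 0)) P.

Definition coeff_mx p (P : 'M[{mpoly R[n]}]_p) (a : 'X_{1..n}) : 'M[R]_p :=
  map_mx (mcoeff a) P.

(* [msize] is the degree plus one; the zero matrix gets degree 0. *)
Definition deg_mx p (P : 'M[{mpoly R[n]}]_p) : nat :=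
  (\max_(i < p) \max_(j < p) (msize (P i j)).-1)%N.

Definition hdeg_mx p (P : 'M[{mpoly R[n]}]_p) : nat := uphalf (deg_mx P).

Definition supp (a : 'X_{1..n}) : {set 'I_n} := [set i | a i != 0%N].

Definition occurs p (P : 'M[{mpoly R[n]}]_p) (i : 'I_n) : Prop :=
  exists2 a, coeff_mx P a != 0 & i \in supp a.

End PolynomialMatrices.

Section Problem.
Context {R : realType} {n p m : nat} {q : 'I_m -> nat}.
Variables (F : 'M[{mpoly R[n]}]_p) (G : forall k, 'M[{mpoly R[n]}]_(q k)).

Definition feasible : set 'rV[R]_n :=
  [set x | forall k, psd (eval_mx (G k) x)]%classic.

Definition lambda_star : \bar R :=
  ereal_inf [set (lambda_min (eval_mx F x))%:E | x in feasible]%classic.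

Definition optimal_solution (x : 'rV[R]_n) : Prop :=
  feasible x /\ (lambda_min (eval_mx F x))%:E = lambda_star.

Definition r_min : nat := maxn (hdeg_mx F) (\max_(k < m) hdeg_mx (G k)).

Definition csp_adj (i j : 'I_n) : Prop :=
  (exists a, [/\ coeff_mx F a != 0, i \in supp a & j \in supp a]) \/
  (exists k, occurs (G k) i /\ occurs (G k) j).

Definition csp_clique (C : {set 'I_n}) : Prop :=
  {in C &, forall i j, i != j -> csp_adj i j}.

Definition csp_maximal_clique (C : {set 'I_n}) : Prop :=
  csp_clique C /\
  forall D : {set 'I_n}, csp_clique D -> C \subset D -> D = C.

Definition enumerates_maximal_cliques t (I : 'I_t -> {set 'I_n}) : Prop :=
  injective I /\ forall C, csp_maximal_clique C <-> exists l, I l = C.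

(* Some of the J l may be empty, so this is not [partition]. *)
Definition constraint_assignment t (I : 'I_t -> {set 'I_n})
    (J : 'I_t -> {set 'I_m}) : Prop :=
  [/\ forall l l', l != l' -> [disjoint J l & J l'],
      \bigcup_l J l = [set: 'I_m]
    & forall l k, k \in J l -> forall i, occurs (G k) i -> i \in I l].

(* The maximum with 1 is the usual convention in flat extension theorems; it
   only matters when the constraints in J are all constant or J is empty. *)
Definition dK (J : {set 'I_m}) : nat := maxn 1 (\max_(k in J) hdeg_mx (G k)).

End Problem.

(* Points of R^I, as functions on the subtype of the indices in I. *)
Notation rpoint R I := {ffun {i | i \in I} -> R}.

Section LocalPoints.
Context {R : realType} {n m : nat} {q : 'I_m -> nat}.
Variable I : {set 'I_n}.

Definition restrict (x : 'rV[R]_n) : rpoint R I := [ffun i => x 0 (val i)].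

Definition extend0 (y : rpoint R I) : 'rV[R]_n := \row_i oapp y 0 (insub i).

Definition monomial_at (y : rpoint R I) (a : 'X_{1..n}) : R :=
  \prod_(i : {i | i \in I}) y i ^+ a (val i).

(* The G k with k \in J only involve variables with index in I, so the value
   given to the other coordinates is irrelevant. *)
Definition local_feasible (G : forall k, 'M[{mpoly R[n]}]_(q k))
    (J : {set 'I_m}) : set (rpoint R I) :=
  [set y | forall k, k \in J -> psd (eval_mx (G k) (extend0 y))]%classic.

End LocalPoints.

Section Moments.
Context {R : realType} {n p : nat}.
(* Moment sequences are total functions on the multi-indices; an r-th order
   relaxation only reads the entries of total degree at most 2r. *)
Implicit Type S : 'X_{1..n} -> 'M[R]_p.

Definition Lfun S (P : 'M[{mpoly R[n]}]_p) : R :=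
  \sum_(a : 'X_{1..n < (deg_mx P).+1}) \tr (coeff_mx P a *m S a).

Definition monomials d (I : {set 'I_n}) : {set 'X_{1..n < d.+1}} :=
  [set a : 'X_{1..n < d.+1} | supp a \subset I].

Definition moment_mx d S (I : {set 'I_n}) :=
  \mxblock_(i < #|monomials d I|, j < #|monomials d I|)
    (S (enum_val i + enum_val j)%MM : 'M[R]_p).

Definition localizing_mx q d (P : 'M[{mpoly R[n]}]_q) S (I : {set 'I_n}) :=
  \mxblock_(i < #|monomials d I|, j < #|monomials d I|)
    (\sum_(c : 'X_{1..n < (deg_mx P).+1})
       S (enum_val i + enum_val j + c)%MM *t coeff_mx P c : 'M[R]_(p * q)).

End Moments.

Section Relaxation.
Context {R : realType} {n p m t : nat} {q : 'I_m -> nat}.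
Variables (F : 'M[{mpoly R[n]}]_p) (G : forall k, 'M[{mpoly R[n]}]_(q k)).
Variables (I : 'I_t -> {set 'I_n}) (J : 'I_t -> {set 'I_m}) (r : nat).
Implicit Type S : 'X_{1..n} -> 'M[R]_p.

Definition cs_feasible : set ('X_{1..n} -> 'M[R]_p) :=
  [set S | [/\ forall a, (mdeg a <= 2 * r)%N -> (S a)^T = S a,
    forall l, psd (moment_mx r S (I l)),
    forall l k, k \in J l ->
      psd (localizing_mx (r - hdeg_mx (G k)) (G k) S (I l))
  & Lfun S 1%:M = 1]]%classic.

Definition lambda_cs : \bar R :=
  ereal_inf [set (Lfun S F)%:E | S in cs_feasible]%classic.

Definition cs_optimal S : Prop :=
  cs_feasible S /\ (Lfun S F)%:E = lambda_cs.

End Relaxation.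

Section AtomRecovery.
Context {R : realType} {n p m : nat} {q : 'I_m -> nat}.

Definition represents (I : {set 'I_n}) r (S : 'X_{1..n} -> 'M[R]_p)
    s (x : 'I_s -> rpoint R I) (W : 'I_s -> 'M[R]_p) : Prop :=
  forall a : 'X_{1..n}, (mdeg a <= 2 * r)%N -> supp a \subset I ->
    S a = \sum_(i < s) monomial_at (x i) a *: W i.

(* The extraction procedure is specified by what it returns: x lists the atoms
   (so the points are distinct and the weights nonzero). *)
Definition extracted (G : forall k, 'M[{mpoly R[n]}]_(q k))
    (I : {set 'I_n}) (J : {set 'I_m}) r (S : 'X_{1..n} -> 'M[R]_p)
    s (x : 'I_s -> rpoint R I) : Prop :=
  [/\ injective x, forall i, local_feasible G J (x i) &
      exists W : 'I_s -> 'M[R]_p,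
        [/\ forall i, psd (W i) /\ W i != 0,
            represents r S x W &
            (\sum_(i < s) \rank (W i) = \rank (moment_mx r S I))%N]].

End AtomRecovery.

(* Main.v *)
(* A rank factorization of the positive semidefinite matrix M_r realizes the
   moments as S_(a + a')(k, l) = <b_(a,k), b_(a',l)> in a Euclidean space of
   dimension N = rank M_r. Flatness provides commuting self-adjoint operators A_i with
   b_(a + e_i, k) = A_i b_(a,k), and since S_0 = v v^T all the b_(a,k) are
   v_k A^a b for a single vector b. A joint eigenbasis of the A_i therefore gives
   N scalar atoms with weights w_j v v^T; testing the localizing matrices on
   interpolation polynomials of the atoms puts them in K_l.

   On an overlap of two cliques, the rank-one condition makes the marginal of the
   atomic measures a Dirac measure, so any choice of one atom per clique patches
   to a feasible point. Split F as a sum of F_l with the monomials of F_l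
   supported in I_l, and choose for each l an atom minimizing v^T F_l v. The
   patched point z has v^T F(z) v <= L_S(F) = lambda_cs <= lambda_star, whereas
   v^T F(z) v >= lambda_min(F(z)) >= lambda_star. All these inequalities are
   equalities, hence every atom is a minimizer and every patched point is
   optimal with eigenvector v. *)
Require Import Defs.
From HB Require Import structures.
From mathcomp Require Import all_boot all_order all_algebra.
From mathcomp Require Import mpoly mxtens.
From mathcomp Require Import classical_sets reals constructive_ereal ereal.
From mathcomp Require boolp.
From mathcomp Require Import ring lra zify.

Set Implicit Arguments.
Unset Strict Implicit.
Unset Printing Implicit Defensive.

Import Order.TTheory GRing.Theory Num.Theory.
Local Open Scope ring_scope.

(** * Quadratic forms *)

Section QuadraticForms.
Context {R : realType}.

(** Row vectors match the row-space conventions of [kermx] and [eigenspace]; [psdP] translates the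
    column-vector form of [psd]. *)
Definition bform k (A : 'M[R]_k) (x y : 'rV[R]_k) : R := (x *m A *m y^T) 0 0.

Lemma bformDl k (A : 'M[R]_k) x y z : bform A (x + y) z = bform A x z + bform A y z.
Proof. by rewrite /bform !mulmxDl mxE. Qed.

Lemma bformZl k (A : 'M[R]_k) c x z : bform A (c *: x) z = c * bform A x z.
Proof. by rewrite /bform -!scalemxAl mxE. Qed.

Lemma bformDr k (A : 'M[R]_k) x y z : bform A z (x + y) = bform A z x + bform A z y.
Proof. by rewrite /bform linearD mulmxDr mxE. Qed.

Lemma bformZr k (A : 'M[R]_k) c x z : bform A z (c *: x) = c * bform A z x.
Proof. by rewrite /bform linearZ -scalemxAr mxE. Qed.

Lemma bform_mx k (A B : 'M[R]_k) c x y :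
  bform (A + c *: B) x y = bform A x y + c * bform B x y.
Proof. by rewrite /bform mulmxDr mulmxDl -scalemxAr -scalemxAl !mxE. Qed.

Lemma bformC k (A : 'M[R]_k) x y : A^T = A -> bform A x y = bform A y x.
Proof.
move=> As; rewrite /bform.
have -> : x *m A *m y^T = (y *m A *m x^T)^T by rewrite !trmx_mul trmxK As mulmxA.
by rewrite mxE.
Qed.

Lemma bform0P k (A : 'M[R]_k) x : (forall y, bform A x y = 0) -> x *m A = 0.
Proof.
move=> h; apply/rowP => j; rewrite [RHS]mxE; have := h (delta_mx 0 j).
by rewrite /bform trmx_delta -colE mxE.
Qed.

Lemma bform_conj k l (A : 'M[R]_k) (B : 'M[R]_(l, k)) x y :
  bform (B *m A *m B^T) x y = bform A (x *m B) (y *m B).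
Proof. by rewrite /bform trmx_mul !mulmxA. Qed.

Lemma psdP k (A : 'M[R]_k) : psd A <-> A^T = A /\ forall x, 0 <= bform A x x.
Proof.
split=> -[As h]; split=> // v; last by have := h v^T; rewrite /bform trmxK.
by have := h v^T; rewrite trmxK.
Qed.

Lemma psd_sym k (A : 'M[R]_k) : psd A -> A^T = A. Proof. by case. Qed.

Lemma psd_ge0 k (A : 'M[R]_k) x : psd A -> 0 <= bform A x x.
Proof. by move/psdP => -[]. Qed.

Lemma psd_conj k l (A : 'M[R]_k) (B : 'M[R]_(l, k)) :
  psd A -> psd (B *m A *m B^T).
Proof.
move/psdP => [As h]; apply/psdP; split; last by move=> x; rewrite bform_conj.
by rewrite !trmx_mul trmxK As mulmxA.
Qed.

Lemma psd1 k : psd (1%:M : 'M[R]_k).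
Proof.
apply/psdP; split; first exact: trmx1.
move=> x; rewrite /bform mulmx1 mxE sumr_ge0 // => i _.
by rewrite mxE -expr2 sqr_ge0.
Qed.

(** The form is nonnegative along the line x + t y, so this quadratic in t has a nonpositive
    discriminant. A vanishing leading coefficient is treated apart. *)
Lemma psd_cauchy_schwarz k (A : 'M[R]_k) x y : psd A ->
  bform A x y ^+ 2 <= bform A x x * bform A y y.
Proof.
move=> hA; have As := psd_sym hA.
have quad t : 0 <= bform A x x + 2 * t * bform A x y + t ^+ 2 * bform A y y.
  have := psd_ge0 (x + t *: y) hA.
  rewrite bformDl !bformDr !bformZl !bformZr (bformC y x As).
  by congr (0 <= _); ring.
have := psd_ge0 x hA; have := psd_ge0 y hA.
move: quad; set a := bform A x x; set b := bform A x y; set c := bform A y y.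
move=> quad; rewrite le0r => /orP[/eqP c0|c_gt0] a_ge0.
  have [->|b0] := eqVneq b 0; first by rewrite c0 mulr0 expr0n.
  (* With [c = 0] the quadratic is affine in t, and this t gives it the value -1. *)
  have := quad (- (a + 1) / (2 * b)); rewrite c0 mulr0 addr0.
  have -> : 2 * (- (a + 1) / (2 * b)) * b = - (a + 1) by field.
  by lra.
(* The minimizer of the quadratic. *)
have := quad (- b / c).
have -> : a + 2 * (- b / c) * b + (- b / c) ^+ 2 * c = (a * c - b ^+ 2) / c.
  by field; rewrite gt_eqF.
by rewrite pmulr_lge0 ?invr_gt0 // subr_ge0.
Qed.

Lemma psd_kernel k (A : 'M[R]_k) x : psd A -> bform A x x = 0 -> x *m A = 0.
Proof.
move=> hA x0; apply: bform0P => y; have := psd_cauchy_schwarz x y hA.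
by rewrite x0 mul0r => h; apply/eqP; rewrite -sqrf_eq0 eq_le h sqr_ge0.
Qed.

Lemma psd_unit_gt0 k (H : 'M[R]_k) x : psd H -> H \in unitmx -> x != 0 ->
  0 < bform H x x.
Proof.
move=> hH uH; apply: contraNT; rewrite -leNgt => h.
have xH : x *m H = 0 by apply: psd_kernel => //; apply: le_anti; rewrite h psd_ge0.
by rewrite -[x](mulmxK uH) xH mul0mx.
Qed.

Lemma bform_bounded k (A : 'M[R]_k) :
  exists2 c, 0 < c & forall x, `|bform A x x| <= c * bform 1%:M x x.
Proof.
(* The summand 1 keeps the constant positive when [A] vanishes. *)
exists (1 + \sum_i \sum_j `|A i j|) => [|x].
  by rewrite ltr_pwDl // !sumr_ge0 // => i _; rewrite sumr_ge0.
have nE : bform 1%:M x x = \sum_i x 0 i ^+ 2.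
  by rewrite /bform mulmx1 mxE; apply: eq_bigr => i _; rewrite mxE.
have n_ge0 : 0 <= bform 1%:M x x by exact: psd_ge0 (psd1 k).
have le_n i j : `|x 0 i * x 0 j| <= bform 1%:M x x.
  rewrite nE; have hi l : x 0 l ^+ 2 <= \sum_i x 0 i ^+ 2.
    by rewrite (bigD1 l) //= lerDl sumr_ge0 // => *; rewrite sqr_ge0.
  have := hi i; have := hi j; set s := \sum_i _.
  have := sqr_ge0 (`|x 0 i| - `|x 0 j|); rewrite sqrrB !real_normK ?num_real // normrM mulr2n.
  by move: (_ * _) => ?; lra.
rewrite mulrDl mul1r -[leLHS]add0r lerD //.
have -> : bform A x x = \sum_i \sum_j A i j * (x 0 i * x 0 j).
  rewrite /bform mxE exchange_big; apply: eq_bigr => j _.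
  rewrite !mxE mulr_suml; apply: eq_bigr => i _; ring.
rewrite mulr_suml; apply: le_trans (ler_norm_sum _ _ _) _.
apply: ler_sum => i _; rewrite mulr_suml.
apply: le_trans (ler_norm_sum _ _ _) _; apply: ler_sum => j _.
by rewrite normrM ler_wpM2l.
Qed.

(* Cauchy-Schwarz with y = x H^-1 turns an upper bound for the form of H^-1
   into a lower bound for that of H. *)
Lemma psd_unit_coercive k (H : 'M[R]_k) : psd H -> H \in unitmx ->
  exists2 c, 0 < c & forall x, bform 1%:M x x <= c * bform H x x.
Proof.
move=> hH uH; have [c c0 hc] := bform_bounded (invmx H).
exists c => // x; have [->|x0] := eqVneq x 0.
  by rewrite /bform !mul0mx !mxE mulr0.
have x1 : 0 < bform 1%:M x x.
  by rewrite psd_unit_gt0 ?unitmx1 //; exact: psd1.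
have := psd_cauchy_schwarz x (x *m invmx H) hH.
have -> : bform H x (x *m invmx H) = bform 1%:M x x.
  rewrite /bform trmx_mul trmx_inv (psd_sym hH) mulmx1.
  by rewrite mulmxA mulmxK.
have -> : bform H (x *m invmx H) (x *m invmx H) = bform (invmx H) x x.
  rewrite /bform trmx_mul trmx_inv (psd_sym hH) mulmxA.
  by rewrite -[x *m invmx H *m H]mulmxA mulVmx // mulmx1.
move=> h; have hx := psd_ge0 x hH.
have {h} : bform 1%:M x x ^+ 2 <= bform H x x * (c * bform 1%:M x x).
  by apply: le_trans h _; rewrite ler_wpM2l // (le_trans (ler_norm _)).
by rewrite expr2 mulrA ler_pM2r // mulrC.
Qed.

(** The least generalized eigenvalue is the largest mu for which K - mu H is psd, obtained as a
    supremum. At the supremum the matrix is singular, since coercivity would otherwise leave room to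
    increase mu, and a kernel vector is the eigenvector. *)
Lemma sym_pencil k (K H : 'M[R]_k) : (0 < k)%N -> K^T = K ->
  psd H -> H \in unitmx ->
  exists mu, psd (K - mu *: H) /\ exists2 y : 'rV_k, y != 0 & y *m K = mu *: (y *m H).
Proof.
move=> k0 Ks hH uH.
have [cK cK0 hcK] := bform_bounded K; have [cH cH0 hcH] := psd_unit_coercive hH uH.
have [dH dH0 hdH] := bform_bounded H.
have sym t : (K - t *: H)^T = K - t *: H.
  by rewrite linearB /= linearZ /= Ks (psd_sym hH).
have bfE t x : bform (K - t *: H) x x = bform K x x - t * bform H x x.
  by rewrite -scaleNr bform_mx mulNr.
pose E := [set t | psd (K - t *: H)]%classic.
have [e0 e0n] : exists x : 'rV[R]_k, x != 0.
  exists (const_mx 1); apply/eqP => /rowP/(_ (Ordinal k0)).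
  by rewrite !mxE; apply/eqP; rewrite oner_eq0.
(* As forms, K is at least -cK times the identity, hence at least -cK cH H. *)
have E0 : E (- (cK * cH)).
  apply/psdP; split=> // x; rewrite bfE mulNr opprK.
  have : - bform K x x <= cK * bform 1%:M x x.
    by rewrite (le_trans _ (hcK x)) // -normrN ler_norm.
  have : cK * bform 1%:M x x <= cK * cH * bform H x x.
    by rewrite -mulrA ler_pM2l.
  by lra.
have Hub : has_ubound E.
  exists (bform K e0 e0 / bform H e0 e0) => t /(psd_ge0 e0).
  by rewrite bfE ler_pdivlMr ?psd_unit_gt0 // subr_ge0.
have hsE : has_sup E by split=> //; exists (- (cK * cH)).
have Esup : psd (K - sup E *: H).
  apply/psdP; split=> // x; rewrite bfE leNgt; apply/negP => hlt.
  have [x0|x0] := eqVneq x 0.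
    by move: hlt; rewrite x0 /bform !mul0mx mxE mulr0 subrr ltxx.
  have Hx := psd_unit_gt0 hH uH x0.
  have : bform K x x / bform H x x < sup E by rewrite ltr_pdivrMr // -subr_lt0.
  move=> /(sup_gt _)-/(_ (ex_intro _ _ E0)) [t /(psd_ge0 x)].
  by rewrite bfE ltr_pdivrMr // subr_ge0 leNgt => /negP.
exists (sup E); split=> //.
have nu : K - sup E *: H \notin unitmx.
  apply/negP => u; have [c c0 hc] := psd_unit_coercive Esup u.
  (* If invertible, the matrix would dominate c^-1 times the identity, hence (c dH)^-1 H, and the
     parameter could still grow. *)
  have /(ub_le_sup Hub) : E (sup E + (c * dH)^-1).
    apply/psdP; split=> // x; rewrite bfE mulrDl opprD addrA.
    have := hc x; rewrite bfE; have := le_trans (ler_norm _) (hdH x).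
    set a := bform H x x; set b := bform K x x - _; set e := bform 1%:M x x.
    move=> h1 h2; rewrite subr_ge0 mulrC ler_pdivrMr ?mulr_gt0 //.
    by apply: le_trans h1 _; rewrite mulrA [leRHS]mulrC ler_pM2l // mulrC.
  by rewrite gerDl invr_le0 leNgt mulr_gt0.
have : kermx (K - sup E *: H) != 0 by rewrite kermx_eq0 row_free_unit.
move=> /rowV0Pn[y /sub_kermxP yK y0]; exists y => //.
by move/eqP: yK; rewrite mulmxBr subr_eq0 -scalemxAr => /eqP.
Qed.

(** For H the identity, the mu of the pencil is an eigenvalue and a lower bound for all eigenvalues,
    so the infimum in [lambda_min] is attained and equals mu. *)
Lemma lambda_minP k (A : 'M[R]_k) : (0 < k)%N -> A^T = A ->
  psd (A - (lambda_min A)%:M) /\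
  exists2 y : 'rV_k, y != 0 & y *m A = lambda_min A *: y.
Proof.
move=> k0 As; have [mu [hmu [y y0 yA]]] := sym_pencil k0 As (psd1 k) (unitmx1 _ _).
suff -> : lambda_min A = mu.
  by split; [rewrite -scalemx1|exists y; rewrite // yA mulmx1].
have lbmu : lbound [set a | eigenvalue A a]%classic mu.
  move=> a /eigenvalueP[x xA x0]; have := psd_ge0 x hmu.
  rewrite /bform mulmxBr xA -scalemxAr mulmx1 -scalerBl -scalemxAl mxE.
  rewrite pmulr_lge0 ?subr_ge0 //.
  by have := psd_unit_gt0 (psd1 k) (unitmx1 _ _) x0; rewrite /bform mulmx1.
have Emu : [set a | eigenvalue A a]%classic mu.
  by apply/eigenvalueP; exists y; rewrite // yA mulmx1.
apply/eqP; rewrite eq_le; apply/andP; split.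
  by apply: ge_inf => //; exists mu.
by apply: lb_le_inf => //; exists mu.
Qed.

End QuadraticForms.

(** * Self-adjoint operators and Gram factorizations *)

Section SelfAdjoint.
Context {R : realType}.

Lemma unitmx_ker0 k (A : 'M[R]_k) :
  (forall x : 'rV_k, x *m A = 0 -> x = 0) -> A \in unitmx.
Proof.
move=> h; rewrite -row_free_unit -kermx_eq0; apply/eqP.
by apply/row_matrixP => i; rewrite row0; apply: h; rewrite -row_mul mulmx_ker row0.
Qed.

Lemma psd_conj_unit k l (H : 'M[R]_k) (B : 'M[R]_(l, k)) :
  psd H -> H \in unitmx -> row_free B -> B *m H *m B^T \in unitmx.
Proof.
move=> hH uH fB; apply: unitmx_ker0 => x xB.
have : bform (B *m H *m B^T) x x = 0 by rewrite /bform xB mul0mx mxE.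
rewrite bform_conj => xB0; apply: (row_free_inj fB); rewrite mul0mx.
apply/eqP; apply: contra_eqT xB0 => /(psd_unit_gt0 hH uH) h.
by rewrite gt_eqF.
Qed.

Lemma row_base_ex m k (U : 'M[R]_(m, k)) :
  exists2 B : 'M_(\rank U, k), row_free B & (B :=: U)%MS.
Proof. by exists (row_base U); [exact: row_base_free | exact: eq_row_base]. Qed.

(** A is self-adjoint for the form H. On a basis B of U it acts by a matrix A', self-adjoint for the
    Gram matrix B H B^T, and an eigenvector of the resulting pencil lifts through B. *)
Lemma selfadjoint_stable_eigenvector k (A H U : 'M[R]_k) :
  psd H -> H \in unitmx -> (A *m H)^T = A *m H -> (U *m A <= U)%MS -> U != 0 ->
  exists mu, exists2 y : 'rV_k, y != 0 & (y <= U)%MS /\ y *m A = mu *: y.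
Proof.
move=> hH uH AH UA U0; have [B fB eB] := row_base_ex U.
have [A' BA] : exists A', B *m A = A' *m B.
  by apply/submxP; rewrite eB (eqmxMr A eB).
have hH' := psd_conj B hH.
have uH' := psd_conj_unit hH uH fB.
set H' := B *m H *m B^T in hH' uH'.
have Ks : (A' *m H')^T = A' *m H'.
  rewrite /H' !mulmxA -BA -[B *m A *m H]mulmxA.
  by rewrite !trmx_mul trmxK -trmx_mul AH mulmxA.
have rU : (0 < \rank U)%N by rewrite lt0n mxrank_eq0.
have [mu [_ [y y0 yK]]] := sym_pencil rU Ks hH' uH'.
exists mu; exists (y *m B).
  by apply: contra_neq y0 => yB; apply: (row_free_inj fB); rewrite mul0mx.
split; first by rewrite (submx_trans (submxMl _ _)) ?eB.
rewrite -mulmxA BA mulmxA scalemxAl; congr (_ *m _).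
apply: (can_inj (mulmxK uH')); by rewrite -mulmxA yK scalemxAl.
Qed.

(** The sum V of the eigenspaces found so far has an A-stable H-orthogonal complement. Unless V is
    everything, the complement contains an eigenvector, which lies outside V by definiteness and
    supplies a new eigenvalue. *)
Lemma selfadjoint_diagonalizable k (A H : 'M[R]_k) :
  psd H -> H \in unitmx -> (A *m H)^T = A *m H -> diagonalizable A.
Proof.
move=> hH uH AH; apply/diagonalizablePeigen.
(* Induction on a bound [d] for the codimension of the sum of the eigenspaces. *)
suff : forall d rs, uniq rs ->
    (k - \rank (\sum_(r <- rs) eigenspace A r)%MS <= d)%N ->
    exists2 rs, uniq rs & (\sum_(r <- rs) eigenspace A r :=: 1%:M)%MS.
  by move=> /(_ _ [::] isT (leqnn _)).
elim=> [|d IH] rs urs.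
  rewrite leqn0 subn_eq0 => h; exists rs => //; apply/eqmxP.
  by rewrite submx1 sub1mx /row_full eqn_leq rank_leq_col.
set V := (\sum_(r <- rs) _)%MS => hd.
have VA : (V *m A <= V)%MS.
  rewrite /V; elim/big_rec: _ => [|a W _ hW]; first by rewrite mul0mx.
  by rewrite addsmxMr addsmxS // comm_mx_stable_eigenspace.
have [fV|nfV] := boolP (row_full V).
  exists rs => //; apply/eqmxP; rewrite submx1; by rewrite sub1mx.
(* The H-orthogonal complement of [V], nonzero because [V] is not full. *)
have [U [U0 UK KU]] : exists U : 'M_k, [/\ U != 0, U *m (H *m V^T) = 0 &
    forall W : 'M_k, W *m (H *m V^T) = 0 -> (W <= U)%MS].
  exists (kermx (H *m V^T)); split; [|exact: mulmx_ker|by move=> W /sub_kermxP].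
  rewrite kermx_eq0 row_free_unit; apply: contra nfV.
  by rewrite unitmx_mul uH /= unitmx_tr row_full_unit.
have UA : (U *m A <= U)%MS.
  apply: KU; have /submxP[Z VZ] := VA.
  have -> : U *m A *m (H *m V^T) = U *m (A *m H) *m V^T by rewrite !mulmxA.
  rewrite -AH trmx_mul (psd_sym hH) -!mulmxA -trmx_mul VZ trmx_mul.
  by rewrite [H *m _]mulmxA mulmxA UK mul0mx.
have [mu [y y0 [yU yA]]] := selfadjoint_stable_eigenvector hH uH AH UA U0.
have yV : ~~ (y <= V)%MS.
  apply/negP => /submxP[z yz]; have := psd_unit_gt0 hH uH y0.
  rewrite /bform {2}yz trmx_mul mulmxA -[y *m H *m _]mulmxA.
  by have /submxP[Z ->] := yU; rewrite -(mulmxA Z) UK mulmx0 mul0mx mxE ltxx.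
have yE : (y <= eigenspace A mu)%MS by apply/eigenspaceP.
have nmu : mu \notin rs.
  apply: contra yV => mrs; apply: submx_trans yE _.
  by rewrite /V (big_rem mu) //= addsmxSl.
apply: (IH (mu :: rs)); first by rewrite /= nmu.
have : (\rank V < \rank (\sum_(r <- mu :: rs) eigenspace A r)%MS)%N.
  apply: rank_ltmx; rewrite ltmxE big_cons addsmxSr /=.
  by apply: contra yV; apply: submx_trans; rewrite (submx_trans yE) // addsmxSl.
move: hd; rewrite !leq_subLR => hd h; rewrite -ltnS (leq_ltn_trans hd) //.
by rewrite addnS ltnS ltn_add2r.
Qed.

(** With B a row basis, M = C B; symmetry puts the rows of C^T in the same row space, so M = B^T H^T
    B. A right inverse of B shows H^T to be a compression of M, hence psd; comparing ranks makes it
    invertible. *)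
Lemma psd_gram k (M : 'M[R]_k) : psd M ->
  exists (B : 'M_(k, \rank M)) (H : 'M_(\rank M)),
    [/\ psd H, H \in unitmx, row_full B & M = B *m H *m B^T].
Proof.
move=> hM; have Ms := psd_sym hM.
suff gen l (B : 'M_(l, k)) : row_free B -> (B :=: M)%MS -> \rank M = l ->
    exists (B : 'M_(k, l)) (H : 'M_l),
    [/\ psd H, H \in unitmx, row_full B & M = B *m H *m B^T].
  by have [B fB eB] := row_base_ex M; apply: gen eB _.
move=> fB eB rM.
have [C MC] : exists C, M = C *m B by apply/submxP; rewrite eB.
have [B' BB'] := row_freeP fB.
have CE : C = M *m B' by rewrite MC -mulmxA BB' mulmx1.
have [H CH] : exists H, C^T = H *m B.
  by apply/submxP; rewrite CE trmx_mul Ms (submx_trans (submxMl _ _)) ?eB.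
have MH : M = B^T *m H^T *m B by rewrite {1}MC -[C]trmxK CH trmx_mul.
have HD : H^T = B'^T *m M *m B'.
  by rewrite MH !mulmxA -trmx_mul BB' trmx1 mul1mx -mulmxA BB' mulmx1.
exists B^T, H^T; split; last by rewrite trmxK.
- by have := psd_conj B'^T hM; rewrite trmxK -HD.
- apply: unitmx_ker0 => x xH.
  have rkH : (l <= \rank H^T)%N.
    have : (\rank M <= \rank H^T)%N.
      by rewrite MH; apply: leq_trans (mxrankM_maxl _ _) (mxrankM_maxr _ _).
    by rewrite rM.
  have fH : row_free H^T by rewrite /row_free eqn_leq rank_leq_row.
  by apply: (row_free_inj fH); rewrite mul0mx.
- by rewrite /row_full mxrank_tr; exact: fB.
Qed.

End SelfAdjoint.

(** * Joint eigenbases and multi-indices *)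

Section JointEigenvectors.
Context {R : realType} {n : nat}.

Definition mon_eval (x : 'rV[R]_n) (a : 'X_{1..n}) : R := \prod_i x 0 i ^+ a i.

Lemma mon_eval0 x : mon_eval x 0%MM = 1.
Proof. by rewrite /mon_eval big1 // => i _; rewrite mnm0E. Qed.

Lemma mon_evalD x a b : mon_eval x (a + b)%MM = mon_eval x a * mon_eval x b.
Proof. by rewrite /mon_eval -big_split; apply: eq_bigr => i _; rewrite mnmDE exprD. Qed.

Lemma mon_evalU x i : mon_eval x U_(i)%MM = x 0 i.
Proof.
rewrite /mon_eval (bigD1 i) //= big1 ?mulr1 ?mnm1E ?eqxx // => j ji.
by rewrite mnm1E eq_sym (negbTE ji).
Qed.

Lemma supp0 : supp (0%MM : 'X_{1..n}) = finset.set0.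
Proof. by apply/setP => i; rewrite !inE mnm0E. Qed.

Lemma suppD (a b : 'X_{1..n}) : supp (a + b)%MM = supp a :|: supp b.
Proof. by apply/setP => i; rewrite !inE mnmDE addn_eq0 negb_and. Qed.

Lemma suppU i : supp (U_(i)%MM : 'X_{1..n}) = [set i].
Proof. by apply/setP => j; rewrite !inE mnm1E [RHS]eq_sym; case: (i == j). Qed.

Lemma mnm_pred d (a : 'X_{1..n}) : mdeg a = d.+1 ->
  exists i b, a = (b + U_(i))%MM /\ mdeg b = d.
Proof.
move=> ad; have [i ai] : exists i, a i != 0%N.
  apply/existsP; move: ad; apply: contra_eqT; rewrite negb_exists => /forallP h.
  suff -> : a = 0%MM by rewrite mdeg0.
  by apply/mnmP => i; rewrite mnm0E; apply/eqP; rewrite -[_ == _]negbK h.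
have ab : a = (a - U_(i) + U_(i))%MM by rewrite submK // lep1mP.
by exists i, (a - U_(i))%MM; move: ad; rewrite {1}ab mdegD mdeg1 addn1 => -[].
Qed.

Lemma mnm_ind (I : {set 'I_n}) (P : 'X_{1..n} -> Prop) : P 0%MM ->
  (forall a i, supp a \subset I -> i \in I -> P a -> P (a + U_(i))%MM) ->
  forall a, supp a \subset I -> P a.
Proof.
move=> P0 PS a; move: {-1}(mdeg a) (erefl (mdeg a)) => d.
elim: d a => [|d IH] a ad aI.
  by move/eqP: ad; rewrite mdeg_eq0 => /eqP ->.
have [i [b [ab bd]]] := mnm_pred ad.
move: aI; rewrite ab suppD suppU finset.subUset finset.sub1set.
by move=> /andP[bI iI]; apply: PS => //; apply: IH.
Qed.

(** Commuting diagonalizable matrices share an eigenbasis, the rows of P. The joint eigenvalues of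
    the j-th row are the coordinates of a future atom [x j]. *)
Lemma codiagonal_basis N (H : 'M[R]_N) (A : 'I_n -> 'M[R]_N) :
  psd H -> H \in unitmx -> (forall i, (A i *m H)^T = A i *m H) ->
  (forall i j, A i *m A j = A j *m A i) ->
  exists2 P : 'M[R]_N, P \in unitmx &
    exists x : 'I_N -> 'rV[R]_n, forall j i, row j P *m A i = x j 0 i *: row j P.
Proof.
move=> hH uH AH AC.
have : codiagonalizable [seq A i | i <- enum 'I_n].
  apply/codiagonalizableP; split.
    by move=> _ _ /mapP[i _ ->] /mapP[j _ ->]; exact: AC.
  by move=> _ /mapP[i _ ->]; apply: selfadjoint_diagonalizable uH (AH i).
move=> [P uP /allP PA]; exists P => //.
have hD i : exists D : 'rV_N, P *m A i == diag_mx D *m P.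
  have /PA/= /diagonalizable_forPex[D /(simmxP uP) ->] : A i \in [seq A i | i <- enum 'I_n].
    by rewrite map_f // mem_enum.
  by exists D.
exists (fun j => \row_i xchoose (hD i) 0 j) => j i.
rewrite mxE -row_mul; have /eqP := xchooseP (hD i); move: (xchoose _) => D ->.
by rewrite row_mul row_diag_mx -scalemxAl -rowE.
Qed.

Lemma unitmx_row_indep N (P : 'M[R]_N) i j (a b : R) : P \in unitmx -> i != j ->
  a *: row i P = b *: row j P -> a = 0.
Proof.
move=> uP ij; rewrite !rowE !scalemxAl => /(can_inj (mulmxK uP))/rowP/(_ i).
by rewrite !mxE !eqxx /= (negbTE ij) mulr0 mulr1.
Qed.

(** * Joint spectrum of the multiplication operators *)

Section Atoms.
Context {N : nat} (H : 'M[R]_N) (A : 'I_n -> 'M[R]_N).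
Context (I : {set 'I_n}) (r : nat) (c : 'X_{1..n} -> 'rV[R]_N).
Hypothesis (hH : psd H) (uH : H \in unitmx).
Hypothesis (AH : forall i, (A i *m H)^T = A i *m H).
Hypothesis (AC : forall i j, A i *m A j = A j *m A i).
Hypothesis A_out : forall i, i \notin I -> A i = 0.
Hypothesis cA : forall a i, supp a \subset I -> i \in I -> (mdeg a < r)%N ->
  c (a + U_(i))%MM = c a *m A i.
Hypothesis c_span : forall y,
  (forall a, supp a \subset I -> (mdeg a <= r)%N -> bform H y (c a) = 0) -> y = 0.

Lemma bform_selfadjoint i x y : bform H (x *m A i) y = bform H x (y *m A i).
Proof.
by rewrite /bform trmx_mul -!mulmxA (mulmxA (A i)) -AH trmx_mul (psd_sym hH) !mulmxA.
Qed.

(** Self-adjointness moves A_i from c_a to the eigenvector, whence <f_j, c_a> = x_j^a <f_j, c_0>. As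
    the c_a span, c_0 is cyclic and the joint spectrum is simple: the points x_j are distinct and
    the f_j orthogonal. The last clause is the Parseval identity. *)
Lemma joint_eigenbasis : exists (x : 'I_N -> 'rV[R]_n) (f : 'I_N -> 'rV[R]_N),
  [/\ injective x, forall j i, i \notin I -> x j 0 i = 0,
      forall j a, supp a \subset I -> (mdeg a <= r)%N ->
        bform H (f j) (c a) = mon_eval (x j) a * bform H (f j) (c 0%MM),
      forall j, bform H (f j) (c 0%MM) != 0 &
      (forall i j, i != j -> bform H (f i) (f j) = 0) /\
      forall y z, bform H y z =
        \sum_j bform H (f j) y * bform H (f j) z / bform H (f j) (f j)].
Proof.
have [P uP [x xP]] := codiagonal_basis hH uH AH AC.
pose f j := row j P; exists x, f.
have f0 j : f j != 0.
  apply/eqP; rewrite /f rowE -{1}(mul0mx _ P) => /(can_inj (mulmxK uP))/rowP/(_ j).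
  by rewrite !mxE !eqxx => /eqP; rewrite oner_eq0.
have fc j a : supp a \subset I -> (mdeg a <= r)%N ->
    bform H (f j) (c a) = mon_eval (x j) a * bform H (f j) (c 0%MM).
  move: a; apply: mnm_ind => [_|a i aI iI IH].
    by rewrite mon_eval0 mul1r.
  rewrite mdegD mdeg1 addn1 => ar; rewrite cA // -bform_selfadjoint xP bformZl IH ?(ltnW ar) //.
  by rewrite mon_evalD mon_evalU mulrA [x _ _ _ * _]mulrC.
have t0 j : bform H (f j) (c 0%MM) != 0.
  apply: contra_neq (f0 j) => h; apply: c_span => a aI ar.
  by rewrite fc // h mulr0.
(* If x_i = x_j, the combination of f_i and f_j cancelling at c_0 is orthogonal to every c_a, hence
   zero, against independence. *)
have xinj : injective x.
  move=> i j xij; apply: contraTeq (t0 j) => ij; rewrite negbK; apply/eqP.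
  apply: (unitmx_row_indep uP ij (b := bform H (f i) (c 0%MM))).
  apply/eqP; rewrite -subr_eq0; apply/eqP; apply: c_span => a aI ar.
  rewrite -scaleNr bformDl !bformZl !(fc _ _ aI ar) xij; ring.
(* Points that differ in coordinate a give f_i and f_j distinct eigenvalues under [A a]. *)
have orth i j : i != j -> bform H (f i) (f j) = 0.
  move=> ij; have [a] : exists a, x i 0 a != x j 0 a.
    apply/existsP; apply: contraNT ij; rewrite negb_exists => /forallP h.
    by apply/eqP/xinj/rowP => a; apply/eqP; rewrite -[_ == _]negbK h.
  apply: contra_neq_eq => h.
  have := bform_selfadjoint a (f i) (f j); rewrite !xP bformZl bformZr => /eqP.
  by rewrite -subr_eq0 -mulrBl mulf_eq0 (negbTE h) orbF subr_eq0 => /eqP.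
split=> //; last split=> //.
  move=> j i iI; have := xP j i; rewrite A_out // mulmx0 => /esym/eqP.
  by rewrite scaler_eq0 (negbTE (f0 j)) orbF => /eqP.
move=> y z; pose w := y *m invmx P.
have yE : y = \sum_j w 0 j *: f j by rewrite -mulmx_sum_row mulmxKV.
have fy j : bform H (f j) y = w 0 j * bform H (f j) (f j).
  rewrite {1}yE /bform linear_sum mulmx_sumr summxE (bigD1 j) //= big1 ?addr0.
    by rewrite linearZ -scalemxAr mxE.
  move=> i ij; rewrite linearZ -scalemxAr mxE.
  by have := @orth j i; rewrite eq_sym ij /bform => ->; rewrite ?mulr0.
rewrite {1}yE /bform !mulmx_suml summxE; apply: eq_bigr => j _.
rewrite -!scalemxAl mxE -/(bform _ _ _) -/(bform H (f j) y) fy.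
by rewrite -/(bform H (f j) (f j)); field; rewrite gt_eqF // psd_unit_gt0.
Qed.

End Atoms.
End JointEigenvectors.

(** * Flat extensions *)

Section FlatExtension.
Context {R : realType} {n p : nat}.

Lemma bform_suml k (H : 'M[R]_k) (J : finType) (f : J -> 'rV_k) (a : J -> R) y :
  bform H (\sum_j a j *: f j) y = \sum_j a j * bform H (f j) y.
Proof.
rewrite /bform !mulmx_suml summxE; apply: eq_bigr => j _.
by rewrite -!scalemxAl mxE.
Qed.

Lemma bform_row k l m (H : 'M[R]_k) (A : 'M_(l, k)) (B : 'M_(m, k)) i j :
  bform H (row i A) (row j B) = (A *m H *m B^T) i j.
Proof. by rewrite /bform -row_mul !mxE; apply: eq_bigr => ? _; rewrite !mxE. Qed.

Lemma row_full_bform k l (H : 'M[R]_k) (T : 'M_(l, k)) y : H \in unitmx ->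
  row_full T -> (forall i, bform H y (row i T) = 0) -> y = 0.
Proof.
move=> uH /row_fullP[L LT] h; apply: (can_inj (mulmxK uH)); rewrite mul0mx.
suff yT : y *m H *m T^T = 0 by rewrite -[y *m H]mulmx1 -trmx1 -LT trmx_mul mulmxA yT mul0mx.
by apply/rowP => i; rewrite [RHS]mxE -(h i) -[in RHS](row_id 0 y) bform_row.
Qed.

Lemma mnm_split r s (a : 'X_{1..n}) : (mdeg a <= r + s)%N ->
  exists b c, [/\ a = (b + c)%MM, (mdeg b <= r)%N & (mdeg c <= s)%N].
Proof.
elim: s => [|s IH] in a *; first by rewrite addn0 => ar; exists a, 0%MM; rewrite addm0 mdeg0.
rewrite addnS leq_eqVlt => /orP[/eqP ad|]; last first.
  by rewrite ltnS => /IH[b [c [-> hb hc]]]; exists b, c; split=> //; exact: leqW.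
have [i [a' [-> /eq_leq/IH[b [c [-> hb hc]]]]]] := mnm_pred ad.
exists b, (c + U_(i))%MM; rewrite addmA mdegD mdeg1 addn1.
by split.
Qed.

Variables (S : 'X_{1..n} -> 'M[R]_p) (I : {set 'I_n}) (r N : nat).
Variables (H : 'M[R]_N) (b : 'X_{1..n} -> 'I_p -> 'rV[R]_N).
Hypotheses (hH : psd H) (uH : H \in unitmx).
Hypothesis gram : forall a a' k k', supp a \subset I -> supp a' \subset I ->
  (mdeg a <= r)%N -> (mdeg a' <= r)%N ->
  bform H (b a k) (b a' k') = S (a + a')%MM k k'.
Variables (D d : nat) (mon : 'I_D -> 'X_{1..n}) (idx : 'I_D -> 'I_p).
Hypotheses (mon_supp : forall x, supp (mon x) \subset I)
  (mon_deg : forall x, (mdeg (mon x) <= d)%N).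
(** [b a k] represents the monomial x^a in the coordinate k. The rows of [T] are such vectors of
    degree at most [d]; that they already span is what flatness will provide. *)
Let T := \matrix_x b (mon x) (idx x).
Hypothesis T_full : row_full T.

Let gramT l (f g : 'I_l -> 'rV[R]_N) :
  (\matrix_x f x) *m H *m (\matrix_x g x)^T = \matrix_(x, y) bform H (f x) (g y).
Proof.
by apply/matrixP => x y; rewrite -bform_row !rowK [RHS]mxE.
Qed.

(** A_i has to send each row of T to its shift by x_i. This is consistent because the inner products
    depend only on sums of exponents; as d < r, shifted monomials still have degree at most r. *)
Lemma multiplication_operators : (d < r)%N ->
  exists A : 'I_n -> 'M[R]_N,
    [/\ forall i, (A i *m H)^T = A i *m H,
        forall i j, A i *m A j = A j *m A i,
        forall i, i \notin I -> A i = 0 &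
        forall a i k, supp a \subset I -> i \in I -> (mdeg a < r)%N ->
          b (a + U_(i))%MM k = b a k *m A i].
Proof.
move=> dr; have [L LT] := row_fullP T_full.
have TL : T^T *m L^T = 1%:M by rewrite -trmx_mul LT trmx1.
pose T' i := \matrix_x b (mon x + U_(i))%MM (idx x).
(* The adjoint of [L *m T' i] for the form H, and 0 for variables outside [I]. *)
pose A i : 'M_N := if i \in I then H *m (T' i)^T *m L^T *m invmx H else 0.
have mU x i : i \in I -> supp (mon x + U_(i))%MM \subset I /\ (mdeg (mon x + U_(i))%MM <= r)%N.
  move=> iI; rewrite suppD suppU finset.subUset finset.sub1set iI mon_supp.
  by rewrite mdegD mdeg1 addn1 (leq_ltn_trans (mon_deg x)).
have md x : (mdeg (mon x) <= r)%N by apply: leq_trans (mon_deg x) (ltnW dr).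
(* Both sides have the entries S_(m_x + m_y + e_i), with m_x the x-th monomial. *)
have TT' i : i \in I -> T' i *m H *m T^T = T *m H *m (T' i)^T.
  move=> iI; rewrite !gramT; apply/matrixP => x y; rewrite !mxE.
  have [? ?] := mU x i iI; have [? ?] := mU y i iI.
  by rewrite !gram // -addmA (addmC U_(i)%MM) addmA.
have TA i : i \in I -> T *m A i = T' i.
  by move=> iI; rewrite /A iI !mulmxA -TT' // -[T' i *m H *m _ *m _]mulmxA TL mulmx1 mulmxK.
have Tcan (X Y : 'M_N) : T *m X *m T^T = T *m Y *m T^T -> X = Y.
  move=> /(congr1 (fun Z => L *m Z *m L^T)).
  by rewrite -!mulmxA TL !mulmx1 !mulmxA LT !mul1mx.
have AH i : (A i *m H)^T = A i *m H.
  have [iI|iI] := boolP (i \in I); last by rewrite /A (negbTE iI) mul0mx trmx0.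
  apply: Tcan; rewrite trmx_mul (psd_sym hH) !mulmxA TA // TT' //.
  by rewrite -TA // trmx_mul !mulmxA.
have AH' i : A i *m H = H *m (A i)^T by rewrite -AH trmx_mul (psd_sym hH).
(* Both sides have the same inner products with the spanning rows of T: the operator moves over to
   the row, which becomes its shift. *)
have bA a i k : supp a \subset I -> i \in I -> (mdeg a < r)%N ->
    b (a + U_(i))%MM k = b a k *m A i.
  move=> aI iI ar; apply/eqP; rewrite -subr_eq0; apply/eqP.
  apply: (row_full_bform uH T_full) => x; rewrite rowK -scaleN1r bformDl bformZl.
  have -> : bform H (b a k *m A i) (b (mon x) (idx x)) = bform H (b a k) (b (mon x + U_(i))%MM (idx x)).
    rewrite /bform -[b a k *m _ *m _]mulmxA AH' mulmxA -mulmxA -trmx_mul.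
    congr ((_ *m _^T) _ _); rewrite -[b (mon x) _](rowK (fun x => b (mon x) (idx x))).
    by rewrite -row_mul -/T TA // rowK.
  have [? ?] := mU x i iI.
  rewrite !gram ?(ltnW ar) //; last 2 first.
  - by rewrite suppD suppU finset.subUset finset.sub1set iI aI.
  - by rewrite mdegD mdeg1 addn1.
  by rewrite mulN1r -addmA (addmC U_(i)%MM) subrr.
exists A; split=> //; last by move=> i iI; rewrite /A (negbTE iI).
move=> i j; have [iI|iI] := boolP (i \in I); last first.
  by rewrite [A i]/A (negbTE iI) mul0mx mulmx0.
have [jI|jI] := boolP (j \in I); last by rewrite [A j]/A (negbTE jI) mul0mx mulmx0.
apply: (can_inj (mulmxK uH)); apply: Tcan.
(* The right-hand side has the entries S_(m_x + m_y + e_i + e_j), symmetric in i and j, so A_i and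
   A_j commute. *)
have E i' j' : i' \in I -> j' \in I ->
    T *m (A i' *m A j' *m H) *m T^T = T' i' *m H *m (T' j')^T.
  by move=> iI' jI'; rewrite -[A i' *m _ *m _]mulmxA AH' !mulmxA TA // -(TA j') // trmx_mul !mulmxA.
rewrite !E // !gramT; apply/matrixP => x y; rewrite !mxE.
have [? ?] := mU x i iI; have [? ?] := mU y i iI.
have [? ?] := mU x j jI; have [? ?] := mU y j jI.
rewrite !gram //; congr (S _ _ _); apply/mnmP => l; rewrite !mnmDE; lia.
Qed.

(** The rank-one S_0 forces b_(a,k) = v_k c_a, first for a = 0 and then by shifting with the A_i.
    The moments become <c_a, c_a'> v v^T, and Parseval in the joint eigenbasis turns the product
    into a sum over atoms. The last clause gives interpolation at the atoms by any spanning
    family. *)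
Lemma atomic_decomposition (v : 'cV[R]_p) : S 0%MM = v *m v^T ->
  \sum_k v k 0 ^+ 2 = 1 -> (d <= r)%N -> (d < r)%N || (r == 0%N) ->
  exists (x : 'I_N -> 'rV[R]_n) (w : 'I_N -> R),
    [/\ injective x, forall j i, i \notin I -> x j 0 i = 0, forall j, 0 < w j,
        forall a, (mdeg a <= 2 * r)%N -> supp a \subset I ->
          S a = \sum_j (w j * mon_eval (x j) a) *: (v *m v^T) &
        forall D' (mon' : 'I_D' -> 'X_{1..n}) (idx' : 'I_D' -> 'I_p),
          (forall l, supp (mon' l) \subset I /\ (mdeg (mon' l) <= r)%N) ->
          row_full (\matrix_l b (mon' l) (idx' l)) ->
          forall j, exists z : 'I_D' -> R, forall i,
            \sum_l z l * mon_eval (x i) (mon' l) * v (idx' l) 0 = (i == j)%:R].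
Proof.
move=> S0 v1 dr drr.
have [A [AH AC Aout bA]] : exists A : 'I_n -> 'M[R]_N,
    [/\ forall i, (A i *m H)^T = A i *m H,
        forall i j, A i *m A j = A j *m A i,
        forall i, i \notin I -> A i = 0 &
        forall a i k, supp a \subset I -> i \in I -> (mdeg a < r)%N ->
          b (a + U_(i))%MM k = b a k *m A i].
  (* For r = 0 the shift relation is void and the zero operators will do. *)
  move: drr => /orP[|/eqP r0]; first exact: multiplication_operators.
  by exists (fun=> 0); split=> // [i|a i k _ _]; rewrite ?mul0mx ?trmx0 ?r0.
pose c a := \sum_k v k 0 *: b a k.
have s0 : supp (0%MM : 'X_{1..n}) \subset I by rewrite supp0 finset.sub0set.
have d0 : (mdeg (0%MM : 'X_{1..n}) <= r)%N by rewrite mdeg0.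
have S0E k l : S 0%MM k l = v k 0 * v l 0 by rewrite S0 !mxE big_ord1 mxE.
(* The difference is orthogonal to all b_(0,l) and is itself a combination of them, hence zero. *)
have b0 k : b 0%MM k = v k 0 *: c 0%MM.
  have h l : bform H (b 0%MM k - v k 0 *: c 0%MM) (b 0%MM l) = 0.
    rewrite -scaleNr bformDl bformZl bform_suml gram // addm0 S0E.
    rewrite (eq_bigr (fun i => v i 0 ^+ 2 * v l 0)); last first.
      by move=> i _; rewrite gram // addm0 S0E; ring.
    by rewrite -mulr_suml v1; ring.
  apply/eqP; rewrite -subr_eq0; apply: contraT => y0.
  have := psd_unit_gt0 hH uH y0; rewrite -{2}scaleNr bformDr bformZr h add0r.
  rewrite bformC ?(psd_sym hH) // bform_suml big1 ?mulr0 ?ltxx // => l _.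
  by rewrite bformC ?(psd_sym hH) // h mulr0.
have bE a k : supp a \subset I -> (mdeg a <= r)%N -> b a k = v k 0 *: c a.
  move=> aI; move: a aI k; apply: mnm_ind => // a i aI iI IH k.
  rewrite mdegD mdeg1 addn1 => ar; rewrite bA // IH ?(ltnW ar) // -scalemxAl.
  congr (_ *: _); rewrite /c mulmx_suml; apply: eq_bigr => l _.
  by rewrite bA // scalemxAl.
have cA a i : supp a \subset I -> i \in I -> (mdeg a < r)%N ->
    c (a + U_(i))%MM = c a *m A i.
  move=> aI iI ar; rewrite /c mulmx_suml; apply: eq_bigr => l _.
  by rewrite bA // scalemxAl.
have c_span y : (forall a, supp a \subset I -> (mdeg a <= r)%N ->
    bform H y (c a) = 0) -> y = 0.
  move=> h; apply: (row_full_bform uH T_full) => x; rewrite rowK.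
  have mr := leq_trans (mon_deg x) dr.
  by rewrite bE // bformZr h // mulr0.
have cgram a a' k l : supp a \subset I -> supp a' \subset I ->
    (mdeg a <= r)%N -> (mdeg a' <= r)%N ->
    S (a + a')%MM k l = v k 0 * v l 0 * bform H (c a) (c a').
  by move=> *; rewrite -gram // !bE // bformZl bformZr mulrA.
have [x [f [xinj xout fc t0 [orth pars]]]] :=
  joint_eigenbasis hH uH AH AC Aout cA c_span.
pose nf j := bform H (f j) (f j); pose t j := bform H (f j) (c 0%MM).
have f0 j : f j != 0.
  by apply: contra_neq (t0 j) => ->; rewrite /bform !mul0mx mxE.
have nf0 j : 0 < nf j by exact: psd_unit_gt0.
(* The weight is the squared norm of the component of c_0 along f_j. *)
exists x, (fun j => t j ^+ 2 / nf j); split=> //.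
- by move=> j; rewrite divr_gt0 // exprn_even_gt0 //= t0.
- move=> a; rewrite mul2n -addnn => /mnm_split[a1 [a2 [-> h1 h2]]].
  rewrite suppD finset.subUset => /andP[s1 s2]; apply/matrixP => k l.
  rewrite cgram // pars summxE mulr_sumr; apply: eq_bigr => j _.
  rewrite mon_evalD (fc j a1) // (fc j a2) //.
  rewrite [RHS]mxE.
  have -> : (v *m v^T) k l = v k 0 * v l 0 by rewrite mxE big_ord1 mxE.
  move: (nf0 j); rewrite /nf /t; move: (bform _ _ _) (bform _ _ _) => e t' e0.
  by field; rewrite gt_eqF.
move=> D' mon' idx' mon'P full' j.
(* Pairing with f_i the expansion of f_j in the spanning family gives t_i times the sum to be
   computed; orthogonality and the factor t_j / <f_j, f_j> normalize it to a Kronecker delta. *)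
have /submxP[z fz] : (f j <= \matrix_l b (mon' l) (idx' l))%MS by rewrite submx_full.
exists (fun l => z 0 l * (t j / nf j)) => i.
have -> : \sum_l z 0 l * (t j / nf j) * mon_eval (x i) (mon' l) * v (idx' l) 0
    = bform H (f i) (f j) * (t j / nf j) / t i.
  rewrite {1}fz mulmx_sum_row bformC ?(psd_sym hH) // bform_suml !mulr_suml.
  apply: eq_bigr => l _; have [? ?] := mon'P l.
  rewrite rowK bformC ?(psd_sym hH) // bE // bformZr fc // -/(t i).
  by field; rewrite t0 gt_eqF.
have [->|ij] := eqVneq i j; last by rewrite orth // !mul0r.
rewrite -/(nf j) mulr1n; field; by rewrite t0 gt_eqF.
Qed.

End FlatExtension.

(** * Block moment matrices *)

Section PolynomialMatrixValues.
Context {R : realType} {n : nat}.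

Lemma msize_deg_mx q (P : 'M[{mpoly R[n]}]_q) i j : (msize (P i j) <= (deg_mx P).+1)%N.
Proof.
suff : ((msize (P i j)).-1 <= deg_mx P)%N by case: (msize _).
apply: leq_trans (leq_bigmax i).
exact: (leq_bigmax (F := fun j => (msize (P i j)).-1) j).
Qed.

Lemma eval_mx_coeff q (P : 'M[{mpoly R[n]}]_q) x :
  eval_mx P x = \sum_(c : 'X_{1..n < (deg_mx P).+1}) mon_eval x c *: coeff_mx P c.
Proof.
apply/matrixP => i j; rewrite summxE mxE {1}(mpolywE (msize_deg_mx P i j)).
rewrite raddf_sum; apply: eq_bigr => c _.
by rewrite /= mevalZ mevalX !mxE mulrC.
Qed.

Lemma eval_mx_sym q (P : 'M[{mpoly R[n]}]_q) x : P^T = P -> (eval_mx P x)^T = eval_mx P x.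
Proof. by move=> Ps; apply/matrixP => i j; rewrite !mxE -[in RHS]Ps mxE. Qed.

Lemma mon_eval_agree (I : {set 'I_n}) (x y : 'rV[R]_n) a : supp a \subset I ->
  (forall i, i \in I -> x 0 i = y 0 i) -> mon_eval x a = mon_eval y a.
Proof.
move=> /fintype.subsetP aI xy; apply: eq_bigr => i _.
have [iI|iI] := boolP (i \in I); first by rewrite xy.
have : i \notin supp a by apply: contra iI; exact: aI.
by rewrite inE negbK => /eqP ->; rewrite !expr0.
Qed.

Lemma coeff_supp q (P : 'M[{mpoly R[n]}]_q) (I : {set 'I_n}) c :
  (forall i, occurs P i -> i \in I) -> coeff_mx P c != 0 -> supp c \subset I.
Proof. by move=> PI c0; apply/fintype.subsetP => i ic; apply: PI; exists c. Qed.

Lemma eval_mx_agree q (P : 'M[{mpoly R[n]}]_q) (I : {set 'I_n}) (x y : 'rV[R]_n) :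
  (forall i, occurs P i -> i \in I) ->
  (forall i, i \in I -> x 0 i = y 0 i) -> eval_mx P x = eval_mx P y.
Proof.
move=> PI xy; rewrite !eval_mx_coeff; apply: eq_bigr => c _.
have [->|c0] := eqVneq (coeff_mx P c) 0; first by rewrite !scaler0.
by rewrite (mon_eval_agree (coeff_supp PI c0) xy).
Qed.

Lemma leq_deg_hdeg q (P : 'M[{mpoly R[n]}]_q) : (deg_mx P <= 2 * hdeg_mx P)%N.
Proof. rewrite /hdeg_mx; lia. Qed.

End PolynomialMatrixValues.

Section Blocks.
Context {n : nat}.

(** [\mxblock] flattens a pair of a monomial and a coordinate into one index; [block_mon] and
    [block_idx] read the pair back. *)
Definition block_dim d (I : {set 'I_n}) q := (\sum_(i < #|monomials d I|) q)%N.

Definition block_mon d I q (x : 'I_(block_dim d I q)) : 'X_{1..n} :=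
  enum_val (tagnat.sig1 x).

Definition block_idx d I q (x : 'I_(block_dim d I q)) : 'I_q := tagnat.sig2 x.

Lemma block_mon_supp d I q (x : 'I_(block_dim d I q)) : supp (block_mon x) \subset I.
Proof. by rewrite /block_mon; move: (enum_val _) (enum_valP (tagnat.sig1 x)) => a; rewrite inE. Qed.

Lemma block_mon_deg d I q (x : 'I_(block_dim d I q)) : (mdeg (block_mon x) <= d)%N.
Proof. by rewrite /block_mon -ltnS; case: (enum_val _). Qed.

Lemma block_surj d (I : {set 'I_n}) q a (k : 'I_q) : supp a \subset I -> (mdeg a <= d)%N ->
  exists x : 'I_(block_dim d I q), block_mon x = a /\ block_idx x = k.
Proof.
move=> aI; rewrite -ltnS => ad.
have aM : BMultinom ad \in monomials d I by rewrite inE.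
exists (tagnat.Rank (p_ := fun=> q) (enum_rank_in aM (BMultinom ad)) k).
rewrite /block_mon /block_idx tagnat.Rank1K enum_rankK_in //; split=> //.
by apply: val_inj; rewrite tagnat.Rank2K.
Qed.

Lemma sum_block (V : nmodType) d (I : {set 'I_n}) q
    (f : 'I_#|monomials d I| -> 'I_q -> V) :
  \sum_(x : 'I_(block_dim d I q)) f (tagnat.sig1 x) (tagnat.sig2 x)
  = \sum_i \sum_k f i k.
Proof.
rewrite (sig_big_dep _ (fun=> predT) f) /=.
rewrite (reindex (tagnat.sig (p_ := fun=> q))) /=.
  by apply: eq_bigr.
exact/onW_bij/tagnat.sig_bij.
Qed.

Lemma sum_tens (V : nmodType) p q (f : 'I_p -> 'I_q -> V) :
  \sum_(x : 'I_(p * q)) f (mxtens_unindex x).1 (mxtens_unindex x).2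
  = \sum_k \sum_l f k l.
Proof.
rewrite pair_big /= (reindex (@mxtens_unindex p q)) //.
by exists (@mxtens_index p q) => x _; rewrite ?mxtens_indexK ?mxtens_unindexK.
Qed.

End Blocks.

(** * Gram vectors and atomic formulas for moment and localizing matrices *)

Section MomentMatrices.
Context {R : realType} {n p : nat}.
Implicit Types (S : 'X_{1..n} -> 'M[R]_p) (I : {set 'I_n}).

Lemma moment_mxE d S I (x y : 'I_(block_dim d I p)) :
  moment_mx d S I x y = S (block_mon x + block_mon y)%MM (block_idx x) (block_idx y).
Proof. by rewrite mxE. Qed.

(** The vectors are the rows of a Gram factor of M_r. Those of degree at most d factor M_d, so equal
    ranks force them to span. *)
Lemma moment_factor S I r : psd (moment_mx r S I) ->
  exists (H : 'M[R]_(\rank (moment_mx r S I)))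
      (b : 'X_{1..n} -> 'I_p -> 'rV[R]_(\rank (moment_mx r S I))),
    [/\ psd H, H \in unitmx,
        forall a a' k k', supp a \subset I -> supp a' \subset I ->
          (mdeg a <= r)%N -> (mdeg a' <= r)%N ->
          bform H (b a k) (b a' k') = S (a + a')%MM k k' &
        forall d, (d <= r)%N -> \rank (moment_mx d S I) = \rank (moment_mx r S I) ->
          row_full (\matrix_(x < block_dim d I p) b (block_mon x) (block_idx x))].
Proof.
move=> /psd_gram[B [H [hH uH fB MB]]].
pose b a k := if [pick x : 'I_(block_dim r I p) | (block_mon x == a) && (block_idx x == k)]
  is Some x then row x B else 0.
have gram a a' k k' : supp a \subset I -> supp a' \subset I ->
    (mdeg a <= r)%N -> (mdeg a' <= r)%N ->
    bform H (b a k) (b a' k') = S (a + a')%MM k k'.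
  move=> aI aI' ar ar'; rewrite /b.
  case: pickP => [x /andP[/eqP xa /eqP xk]|h]; last first.
    by have [x [xa xk]] := block_surj k aI ar; have := h x; rewrite xa xk !eqxx.
  case: pickP => [y /andP[/eqP ya /eqP yk]|h]; last first.
    by have [y [xa' xk']] := block_surj k' aI' ar'; have := h y; rewrite xa' xk' !eqxx.
  by rewrite bform_row -MB moment_mxE xa xk ya yk.
exists H, b; split=> // d dr rk.
set T := \matrix_x _; have : moment_mx d S I = T *m H *m T^T.
  apply/matrixP => x y; rewrite -bform_row !rowK.
  rewrite gram ?block_mon_supp ?(leq_trans (block_mon_deg _)) //.
  exact: moment_mxE.
move=> E; rewrite /row_full eqn_leq rank_leq_col -{1}rk E -mulmxA.
exact: mxrankM_maxl.
Qed.

(** The monomial vector of x tensored with v and with the identity of size q: conjugating P(x) by it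
    gives the localizing matrix of the measure v v^T delta_x. *)
Definition loc_vec d I q (v : 'cV[R]_p) (x : 'rV[R]_n) :=
  \matrix_(i < block_dim d I (p * q), l < q)
    (mon_eval x (block_mon i) * v (mxtens_unindex (block_idx i)).1 0
     * (l == (mxtens_unindex (block_idx i)).2)%:R).

Lemma loc_vec_conj d I q (A : 'M[R]_q) v x y z :
  (loc_vec d I q v x *m A *m (loc_vec d I q v x)^T) y z =
  mon_eval x (block_mon y) * v (mxtens_unindex (block_idx y)).1 0 *
  A (mxtens_unindex (block_idx y)).2 (mxtens_unindex (block_idx z)).2 *
  (mon_eval x (block_mon z) * v (mxtens_unindex (block_idx z)).1 0).
Proof.
have YE i l : loc_vec d I q v x i l = mon_eval x (block_mon i) *
    v (mxtens_unindex (block_idx i)).1 0 * (l == (mxtens_unindex (block_idx i)).2)%:R.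
  by rewrite mxE.
move: (mxtens_unindex (block_idx y)) (mxtens_unindex (block_idx z)) (YE y) (YE z) => [y1 y2] [z1 z2] /= Yy Yz.
rewrite mxE (bigD1 z2) //= big1 ?addr0; last first.
  by move=> l /negbTE h; rewrite [_^T _ _]mxE Yz h !mulr0.
rewrite [_^T _ _]mxE Yz eqxx mulr1; congr (_ * _).
rewrite mxE (bigD1 y2) //= big1 ?addr0; last first.
  by move=> l /negbTE h; rewrite Yy h mulr0 mul0r.
by rewrite Yy eqxx mulr1.
Qed.

Lemma localizing_atomic d q (P : 'M[{mpoly R[n]}]_q) S I v s
    (x : 'I_s -> 'rV[R]_n) (w : 'I_s -> R) :
  (forall i, occurs P i -> i \in I) ->
  (forall a, (mdeg a <= 2 * d + deg_mx P)%N -> supp a \subset I ->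
     S a = \sum_j (w j * mon_eval (x j) a) *: (v *m v^T)) ->
  localizing_mx d P S I = \sum_j w j *:
    (loc_vec d I q v (x j) *m eval_mx P (x j) *m (loc_vec d I q v (x j))^T).
Proof.
move=> PI hS; apply/matrixP => y z; rewrite summxE mxE summxE.
under [RHS]eq_bigr => j _.
  rewrite mxE loc_vec_conj eval_mx_coeff summxE mulr_sumr mulr_suml mulr_sumr; over.
rewrite exchange_big; apply: eq_bigr => c _ /=.
rewrite mxE -/(block_mon y) -/(block_mon z) -/(block_idx y) -/(block_idx z).
(* Only exponents with a nonzero coefficient are known to be supported in [I]. *)
have [c0|c0] := eqVneq (coeff_mx P c) 0.
  by rewrite c0 !mxE mulr0 big1 // => j _; rewrite !mxE; ring.
rewrite hS; last 2 first.
- rewrite !mdegD; have := bmdeg c; have := block_mon_deg y; have := block_mon_deg z; lia.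
- by rewrite !suppD !finset.subUset !block_mon_supp (coeff_supp PI).
rewrite summxE mulr_suml; apply: eq_bigr => j _.
by rewrite !mxE big_ord1 mxE !mon_evalD; ring.
Qed.

Lemma moment_atomic d S I (v : 'cV[R]_p) s (x : 'I_s -> 'rV[R]_n) (w : 'I_s -> R) :
  (forall a, (mdeg a <= 2 * d)%N -> supp a \subset I ->
     S a = \sum_j (w j * mon_eval (x j) a) *: (v *m v^T)) ->
  let Y j := \col_(y < block_dim d I p) (mon_eval (x j) (block_mon y) * v (block_idx y) 0) in
  moment_mx d S I = \sum_j w j *: (Y j *m (Y j)^T).
Proof.
move=> hS Y; apply/matrixP => y z; rewrite summxE moment_mxE hS; last 2 first.
- by rewrite mdegD mul2n -addnn leq_add ?block_mon_deg.
- by rewrite suppD finset.subUset !block_mon_supp.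
rewrite summxE; apply: eq_bigr => j _.
by rewrite !mxE !big_ord1 !mxE mon_evalD; ring.
Qed.

(* The test vector is the tensor product of an interpolation polynomial of the
   atom x j with u. *)
Lemma localizing_atom_psd d q (P : 'M[{mpoly R[n]}]_q) S I (v : 'cV[R]_p) s
    (x : 'I_s -> 'rV[R]_n) (w : 'I_s -> R) j (z : 'I_(block_dim d I p) -> R) :
  (forall i, occurs P i -> i \in I) ->
  (forall a, (mdeg a <= 2 * d + deg_mx P)%N -> supp a \subset I ->
     S a = \sum_j (w j * mon_eval (x j) a) *: (v *m v^T)) ->
  (forall i, \sum_l z l * mon_eval (x i) (block_mon l) * v (block_idx l) 0
     = (i == j)%:R) ->
  0 < w j -> P^T = P -> psd (localizing_mx d P S I) -> psd (eval_mx P (x j)).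
Proof.
move=> PI hS hz wj Ps hL; apply/psdP; split=> [|u]; first exact: eval_mx_sym.
pose zeta : 'rV[R]_(block_dim d I (p * q)) :=
  \row_l (z (tagnat.Rank (p_ := fun=> p) (tagnat.sig1 l) (mxtens_unindex (block_idx l)).1)
          * u 0 (mxtens_unindex (block_idx l)).2).
have zY i : zeta *m loc_vec d I q v (x i) = (i == j)%:R *: u.
  apply/rowP => k; rewrite !mxE -hz.
  pose g i' k' := z (tagnat.Rank (p_ := fun=> p) i' k') * mon_eval (x i) (enum_val i') * v k' 0.
  rewrite (eq_bigr (fun l => g (tagnat.sig1 l) (mxtens_unindex (block_idx l)).1
      * (u 0 (mxtens_unindex (block_idx l)).2 * (k == (mxtens_unindex (block_idx l)).2)%:R))).
    rewrite (sum_block (fun i' kl => g i' (mxtens_unindex kl).1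
      * (u 0 (mxtens_unindex kl).2 * (k == (mxtens_unindex kl).2)%:R))).
    rewrite [in RHS](eq_bigr (fun l => g (tagnat.sig1 l) (tagnat.sig2 l))).
      rewrite (sum_block g) mulr_suml; apply: eq_bigr => i' _.
      rewrite (sum_tens (fun k' l => g i' k' * (u 0 l * (k == l)%:R))) mulr_suml.
      apply: eq_bigr => k' _; rewrite (bigD1 k) //= big1 ?addr0 ?eqxx ?mulr1 //.
      by move=> l /negbTE; rewrite eq_sym => ->; rewrite !mulr0.
    by move=> l _; rewrite /g tagnat.sig2K.
  by move=> l _; rewrite !mxE /g -/(block_mon l); ring.
have := psd_ge0 zeta hL; rewrite (localizing_atomic PI hS) /bform.
rewrite mulmx_sumr mulmx_suml summxE (bigD1 j) //= big1 ?addr0.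
  rewrite -scalemxAr -scalemxAl mxE -/(bform _ zeta zeta) bform_conj zY eqxx scale1r.
  by rewrite pmulr_rge0.
move=> i /negbTE ij; rewrite -scalemxAr -scalemxAl mxE -/(bform _ zeta zeta) bform_conj zY ij.
by rewrite scale0r /bform !mul0mx mxE mulr0.
Qed.

Lemma psdZ k c (A : 'M[R]_k) : 0 <= c -> psd A -> psd (c *: A).
Proof.
move=> c0 hA; apply/psdP; split; first by rewrite linearZ /= (psd_sym hA).
by move=> y; rewrite /bform -scalemxAr -scalemxAl mxE mulr_ge0 // (psd_ge0 y hA).
Qed.

Lemma psd_sum (J : finType) (P : pred J) k (A : J -> 'M[R]_k) :
  (forall j, P j -> psd (A j)) -> psd (\sum_(j | P j) A j).
Proof.
move=> hA; apply/psdP; split.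
  by rewrite linear_sum; apply: eq_bigr => j /hA; exact: psd_sym.
move=> y; rewrite /bform mulmx_sumr mulmx_suml summxE sumr_ge0 // => j /hA.
exact: psd_ge0.
Qed.

End MomentMatrices.

(** * Atoms of a single clique *)

Section RankOne.
Context {R : realType} {n p : nat}.
Implicit Types (S : 'X_{1..n} -> 'M[R]_p) (v : 'cV[R]_p).

Lemma Lfun_1 S : Lfun S 1%:M = \tr (S 0%MM).
Proof.
have cE a : coeff_mx (1%:M : 'M[{mpoly R[n]}]_p) a = (a == 0%MM)%:R%:M.
  apply/matrixP => i j; rewrite !mxE; case: (i == j) => /=.
    by rewrite mcoeff1.
  by rewrite mcoeff0.
rewrite /Lfun (bigD1 bm0) //= big1 ?addr0.
  by rewrite cE eqxx mul1mx.
move=> a a0; rewrite cE.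
have -> : (bmnm a == 0%MM) = false by apply/negbTE; rewrite -val_eqE in a0.
by rewrite raddf0 mul0mx mxtrace0.
Qed.

Lemma trace_outer v : \tr (v *m v^T) = \sum_k v k 0 ^+ 2.
Proof. by apply: eq_bigr => k _; rewrite !mxE big_ord1 mxE expr2. Qed.

Lemma bform1_outer v : bform 1%:M v^T v^T = \sum_k v k 0 ^+ 2.
Proof. by rewrite /bform mulmx1 mxE; apply: eq_bigr => k _; rewrite !mxE expr2. Qed.

Lemma psd_outer v : psd (v *m v^T).
Proof. by have := psd_conj v (psd1 1); rewrite mulmx1. Qed.

Lemma rank1_psd (A : 'M[R]_p) : psd A -> \rank A = 1%N -> exists v : 'cV_p, A = v *m v^T.
Proof.
move=> hA rA; have := psd_gram hA; rewrite rA => -[B [H [hH _ _ ->]]].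
exists (Num.sqrt (H 0 0) *: B); rewrite [in LHS](mx11_scalar H) mul_mx_scalar.
have h0 : 0 <= H 0 0.
  have := psd_ge0 (1%:M : 'rV_1) hH.
  by rewrite /bform mul1mx trmx1 mulmx1.
by rewrite linearZ /= -!scalemxAl -scalemxAr scalerA -expr2 sqr_sqrtr.
Qed.

Lemma moment_mx_S0_psd r S I : psd (moment_mx r S I) -> psd (S 0%MM).
Proof.
move=> /moment_factor[H [b [hH _ gram _]]].
have s0 : supp (0%MM : 'X_{1..n}) \subset I by rewrite supp0 finset.sub0set.
have -> : S 0%MM = (\matrix_k b 0%MM k) *m H *m (\matrix_k b 0%MM k)^T.
  apply/matrixP => k l; rewrite -bform_row !rowK gram ?mdeg0 //.
  by rewrite addm0.
exact: psd_conj.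
Qed.

(* W is dominated by v v^T, so its kernel contains the orthogonal complement
   of v. *)
Lemma psd_summand_rank1 (W W' : 'M[R]_p) v : \sum_k v k 0 ^+ 2 = 1 ->
  psd W -> psd W' -> W + W' = v *m v^T -> W = (v^T *m W *m v) 0 0 *: (v *m v^T).
Proof.
move=> v1 hW hW' E.
have vv : v^T *m v = 1%:M.
  rewrite [LHS]mx11_scalar; congr (_%:M); rewrite mxE -v1.
  by apply: eq_bigr => k _; rewrite mxE.
have P (u : 'rV_p) : u *m v = 0 -> u *m W = 0.
  move=> uv; apply: psd_kernel => //; apply: le_anti; rewrite psd_ge0 // andbT.
  have : bform (W + W') u u = 0.
    by rewrite E /bform mulmxA uv !mul0mx mxE.
  rewrite -[W']scale1r bform_mx mul1r => h.
  by rewrite -h lerDl psd_ge0.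
have PW : W = v *m v^T *m W.
  apply/eqP; rewrite -subr_eq0 -{1}[W]mul1mx -mulmxBl; apply/eqP.
  apply/row_matrixP => i; rewrite row_mul row0 P // -row_mul mulmxBl mul1mx.
  by rewrite -mulmxA vv mulmx1 subrr row0.
have WP : W = W *m v *m v^T.
  by have := congr1 trmx PW; rewrite !trmx_mul trmxK (psd_sym hW) mulmxA.
rewrite {1}PW {1}WP.
have -> : v *m v^T *m (W *m v *m v^T) = v *m (v^T *m W *m v) *m v^T by rewrite !mulmxA.
by rewrite [v^T *m W *m v]mx11_scalar mul_mx_scalar -scalemxAl !mxE.
Qed.

End RankOne.

(** * Extraction of atoms and marginals on overlaps *)

Section LocalAtoms.
Context {R : realType} {n p : nat}.
Implicit Types (S : 'X_{1..n} -> 'M[R]_p) (I : {set 'I_n}) (v : 'cV[R]_p).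

(** Unlike in [represents], the matrix weights are multiples of the one matrix v v^T, and the atoms
    live in R^n. *)
Definition atomic_rep S I r v s (X : 'I_s -> 'rV[R]_n) (w : 'I_s -> R) :=
  forall a, (mdeg a <= 2 * r)%N -> supp a \subset I ->
    S a = \sum_j (w j * mon_eval (X j) a) *: (v *m v^T).

Lemma extend0E I (y : rpoint R I) i (iI : i \in I) : extend0 y 0 i = y (exist _ i iI).
Proof. by rewrite mxE insubT. Qed.

Lemma extend0_restrict I (x : 'rV[R]_n) i : i \in I -> extend0 (restrict I x) 0 i = x 0 i.
Proof. by move=> iI; rewrite extend0E ffunE. Qed.

Lemma restrict_eq I (x : 'rV[R]_n) (y : rpoint R I) :
  restrict I x = y <-> forall i, i \in I -> x 0 i = extend0 y 0 i.
Proof.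
split=> [<- i iI|h]; first by rewrite extend0_restrict.
by apply/ffunP => -[i iI]; rewrite ffunE /= h // extend0E.
Qed.

Lemma monomial_atE I (y : rpoint R I) a : supp a \subset I ->
  monomial_at y a = mon_eval (extend0 y) a.
Proof.
move=> /fintype.subsetP aI; rewrite /monomial_at /mon_eval.
rewrite [RHS](bigID (mem I)) /= [X in _ * X]big1 ?mulr1; last first.
  move=> i iI; have : i \notin supp a by apply: contra iI; exact: aI.
  by rewrite inE negbK => /eqP ->.
rewrite (reindex_omap (op := *%R) (val : {i | i \in I} -> 'I_n) insub) /=; last first.
  by move=> i iI; rewrite insubT.
apply: eq_big => [[i iI]|[i iI] _]; last by rewrite extend0E.
by rewrite /= iI insubT eqxx.
Qed.

(** Interpolation is available at every order [d1] from d to r because the vectors of degree at most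
    d already span; the localizing matrices have such orders. *)
Lemma flat_atoms S I r d v : psd (moment_mx r S I) ->
  \rank (moment_mx d S I) = \rank (moment_mx r S I) ->
  (d <= r)%N -> (d < r)%N || (r == 0%N) ->
  S 0%MM = v *m v^T -> \sum_k v k 0 ^+ 2 = 1 ->
  exists (X : 'I_(\rank (moment_mx r S I)) -> 'rV[R]_n) (w : 'I_(\rank (moment_mx r S I)) -> R),
    [/\ injective X, forall j i, i \notin I -> X j 0 i = 0, forall j, 0 < w j,
        atomic_rep S I r v X w &
        forall d1, (d <= d1 <= r)%N -> forall j,
          exists z : 'I_(block_dim d1 I p) -> R, forall i,
          \sum_l z l * mon_eval (X i) (block_mon l) * v (block_idx l) 0 = (i == j)%:R].
Proof.
move=> hM rk dr drr S0 v1; have [H [b [hH uH gram full]]] := moment_factor hM.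
have fd := full d dr rk.
have [X [w [Xi Xo w0 rep interp]]] := atomic_decomposition hH uH gram
  (@block_mon_supp _ d I p) (@block_mon_deg _ d I p) fd S0 v1 dr drr.
exists X, w; split=> // d1 /andP[dd1 d1r] j; apply: interp.
  by move=> l; rewrite block_mon_supp (leq_trans (block_mon_deg l)).
rewrite -sub1mx; apply: submx_trans (_ : _ <= \matrix_(x < block_dim d I p) b (block_mon x) (block_idx x))%MS _.
  by rewrite sub1mx.
apply/row_subP => x; rewrite rowK.
have [y [ya yk]] := block_surj (block_idx x) (block_mon_supp x)
  (leq_trans (block_mon_deg x) dd1).
by rewrite -ya -yk; have := row_sub y (\matrix_l b (block_mon l) (block_idx l)); rewrite rowK.
Qed.

Context {m : nat} {q : 'I_m -> nat} (G : forall k, 'M[{mpoly R[n]}]_(q k)).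

(** The atoms provided by flatness, restricted to the clique, meet the specification of the
    extraction procedure, which is therefore not vacuous. *)
Lemma extraction_exists S I (J : {set 'I_m}) r v :
  (forall k, k \in J -> (G k)^T = G k) ->
  (forall k, k \in J -> (hdeg_mx (G k) <= r)%N) ->
  (forall k, k \in J -> forall i, occurs (G k) i -> i \in I) ->
  psd (moment_mx r S I) ->
  (forall k, k \in J -> psd (localizing_mx (r - hdeg_mx (G k)) (G k) S I)) ->
  \rank (moment_mx r S I) = \rank (moment_mx (r - dK G J) S I) ->
  S 0%MM = v *m v^T -> \sum_k v k 0 ^+ 2 = 1 ->
  exists x : 'I_(\rank (moment_mx r S I)) -> rpoint R I, extracted G J r S x.
Proof.
move=> Gs Gr GI hM hL rk S0 v1.
have dKJ k : k \in J -> (hdeg_mx (G k) <= dK G J)%N.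
  by move=> kJ; rewrite /dK leq_max (leq_bigmax_cond (F := fun k => hdeg_mx (G k))) ?orbT.
have dK1 : (1 <= dK G J)%N by rewrite leq_maxl.
(* The lower bound 1 in [dK] makes the order drop strictly, except when r = 0. *)
have drr : (r - dK G J < r)%N || (r == 0%N) by move: (dK G J) dK1 => e; lia.
have [X [w [Xi Xo w0 rep interp]]] :=
  flat_atoms hM (esym rk) (leq_subr _ _) drr S0 v1.
have Xe j : extend0 (restrict I (X j)) = X j.
  apply/rowP => i; have [iI|iI] := boolP (i \in I); first by rewrite extend0_restrict.
  by rewrite mxE Xo // insubN.
have v0 : v *m v^T != 0.
  by apply/eqP => h; have := trace_outer v; rewrite h v1 mxtrace0 => /eqP; rewrite eq_sym oner_eq0.
exists (fun j => restrict I (X j)); split.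
- by move=> i j /(congr1 (@extend0 _ _ I)); rewrite !Xe => /Xi.
- move=> j k kJ; rewrite Xe.
  (* As d_k is at most [dK G J], the order r - d_k is high enough for interpolation at the atoms. *)
  have hk : (r - dK G J <= r - hdeg_mx (G k) <= r)%N by rewrite leq_subr leq_sub2l ?dKJ.
  have [z hz] := interp _ hk j.
  apply: (localizing_atom_psd (GI k kJ) _ hz (w0 j) (Gs k kJ) (hL k kJ)) => a ha.
  apply: rep; apply: leq_trans ha _.
  by have := leq_deg_hdeg (G k); have := Gr k kJ; move: (hdeg_mx _) (deg_mx _); lia.
exists (fun j => w j *: (v *m v^T)); split.
- move=> j; split; last by rewrite scaler_eq0 negb_or v0 gt_eqF.
  by apply: psdZ (psd_outer v); exact: ltW.
- move=> a ar aI; rewrite rep //; apply: eq_bigr => j _.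
  by rewrite monomial_atE // Xe scalerA mulrC.
(* Every weight has rank one, so the ranks add up to the number of atoms. *)
transitivity (\sum_(j < \rank (moment_mx r S I)) 1)%N; last first.
  by rewrite sum_nat_const card_ord muln1.
apply: eq_bigr => j _.
rewrite mxrank_scale_nz ?gt_eqF //; apply/eqP.
rewrite eqn_leq lt0n mxrank_eq0 v0 andbT.
by apply: leq_trans (mxrankM_maxl _ _) (rank_leq_col _).
Qed.

(** The weights of any extracted measure sum to S_0 = v v^T, so each is dominated by it and is a
    multiple w_j v v^T; traces give the total mass 1. *)
Lemma extracted_weights S I (J : {set 'I_m}) r v s (x : 'I_s -> rpoint R I) :
  extracted G J r S x -> S 0%MM = v *m v^T -> \sum_k v k 0 ^+ 2 = 1 ->
  exists w : 'I_s -> R, [/\ forall j, 0 < w j, \sum_j w j = 1 &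
    atomic_rep S I r v (fun j => extend0 (x j)) w].
Proof.
move=> [_ _ [W [hW rep _]]] S0 v1.
have sW : \sum_j W j = v *m v^T.
  rewrite -S0 rep ?mdeg0 ?supp0 ?finset.sub0set //; apply: eq_bigr => j _.
  by rewrite monomial_atE ?supp0 ?finset.sub0set // mon_eval0 scale1r.
pose w j := (v^T *m W j *m v) 0 0.
have WE j : W j = w j *: (v *m v^T).
  apply: (psd_summand_rank1 v1 (W' := \sum_(i | i != j) W i)); first by case: (hW j).
    by apply: psd_sum => i _; case: (hW i) => -[].
  by rewrite -sW [RHS](bigD1 j).
exists w; split.
- move=> j; have [hj Wj0] := hW j; rewrite lt_neqAle; apply/andP; split.
    by apply: contra_neq Wj0 => h; rewrite WE -h scale0r.
  by have := hj.2 v.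
- have := trace_outer v; rewrite v1 -sW => <-.
  rewrite raddf_sum; apply: eq_bigr => j _.
  by rewrite /= {1}WE mxtraceZ trace_outer v1 mulr1.
move=> a ar aI; rewrite rep //; apply: eq_bigr => j _.
by rewrite monomial_atE // [in LHS]WE scalerA mulrC.
Qed.

Lemma rank1_minor k l (A : 'M[R]_(k, l)) i i' j j' : (\rank A <= 1)%N ->
  A i j * A i' j' = A i j' * A i' j.
Proof.
move=> rA; have E i0 j0 : A i0 j0 = \sum_(h < \rank A) col_base A i0 h * row_base A h j0.
  by rewrite -{1}[A]mulmx_base mxE.
rewrite !E; move: (col_base A) (row_base A); case: (\rank A) rA => [|[|//]] _ B C.
  by rewrite !big_ord0 !mul0r.
by rewrite !big_ord1; ring.
Qed.

(* The rank-one condition says that the marginal of the atomic measure has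
   variance zero. *)
Lemma rank1_marginal S I I' r v s (X : 'I_s -> 'rV[R]_n) (w : 'I_s -> R) a :
  atomic_rep S I r v X w -> (forall j, 0 < w j) -> \sum_j w j = 1 ->
  \sum_k v k 0 ^+ 2 = 1 -> (0 < r)%N -> a \in I' -> I' \subset I ->
  \rank (moment_mx r S I') = 1%N ->
  forall j, X j 0 a *: (v *m v^T) = S U_(a)%MM.
Proof.
move=> rep w0 w1 v1 r0 aI' I'I rk j.
have [k vk] : exists k, v k 0 != 0.
  apply/existsP; apply: contraT; rewrite negb_exists => /forallP h.
  move: v1; rewrite big1 ?(eq_sym 0) => [/eqP|k _]; first by rewrite eq_sym oner_eq0.
  by have := h k; rewrite negbK => /eqP ->; rewrite expr0n.
have aI : a \in I by apply: (fintype.subsetP I'I).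
have sa I0 : a \in I0 -> supp (U_(a)%MM : 'X_{1..n}) \subset I0 by move=> ?; rewrite suppU finset.sub1set.
have s0 I0 : supp (0%MM : 'X_{1..n}) \subset I0 by rewrite supp0 finset.sub0set.
have d1 : (mdeg (U_(a)%MM : 'X_{1..n}) <= r)%N by rewrite mdeg1.
have d0 : (mdeg (0%MM : 'X_{1..n}) <= r)%N by rewrite mdeg0.
have [y [ya yk]] := block_surj k (sa _ aI') d1.
have [z [za zk]] := block_surj k (s0 I') d0.
(* The minor on the rows of 1 and x_a, in a coordinate k with v_k nonzero, says that the second
   moment of x_a is the square of its mean, up to a power of v_k. *)
have := rank1_minor z y z y (eq_leq rk); rewrite !moment_mxE ya yk za zk.
have SE b : (mdeg b <= 2 * r)%N -> supp b \subset I ->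
    S b = (\sum_j w j * mon_eval (X j) b) *: (v *m v^T).
  by move=> ? ?; rewrite rep // scaler_suml.
rewrite addm0 add0m addm0 !SE ?suppD ?finset.subUset ?sa ?s0 ?mdegD ?mdeg0 ?mdeg1 //; try lia.
pose mu := \sum_j w j * X j 0 a.
have -> : \sum_j w j * mon_eval (X j) U_(a)%MM = mu.
  by apply: eq_bigr => i _; rewrite mon_evalU.
have -> : \sum_j w j * mon_eval (X j) 0%MM = 1.
  by rewrite -w1; apply: eq_bigr => i _; rewrite mon_eval0 mulr1.
have -> : \sum_j w j * mon_eval (X j) (U_(a) + U_(a))%MM = \sum_j w j * X j 0 a ^+ 2.
  by apply: eq_bigr => i _; rewrite mon_evalD !mon_evalU expr2.
rewrite !mxE big_ord1 mxE => h.
have h2 : \sum_j w j * X j 0 a ^+ 2 = mu ^+ 2.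
  have vk4 : (v k 0 * v k 0) * (v k 0 * v k 0) != 0 by rewrite !mulf_neq0.
  apply: (mulIf vk4); move: h; move: (\sum_j _) mu (v k 0) => s2 e V h.
  by apply: etrans (etrans h _); ring.
have var : \sum_j w j * (X j 0 a - mu) ^+ 2 = 0.
  rewrite (eq_bigr (fun j => w j * X j 0 a ^+ 2 + (- (mu *+ 2) * (w j * X j 0 a) + mu ^+ 2 * w j))); last first.
    by move=> i _; ring.
  rewrite !big_split /= -!mulr_sumr h2 w1 -/mu; ring.
congr (_ *: _); apply/eqP; rewrite -subr_eq0 -sqrf_eq0.
move/eqP: var; rewrite psumr_eq0 => [/allP/(_ j (mem_index_enum _))/=|i _].
  by rewrite mulf_eq0 gt_eqF //=.
by rewrite mulr_ge0 ?sqr_ge0 // ltW.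
Qed.

End LocalAtoms.

(** * Exactness of the relaxation *)

Section Relaxation.
Context {R : realType} {n p m t : nat} {q : 'I_m -> nat}.
Variables (F : 'M[{mpoly R[n]}]_p) (G : forall k : 'I_m, 'M[{mpoly R[n]}]_(q k)).
Variables (I : 'I_t -> {set 'I_n}) (J : 'I_t -> {set 'I_m}) (r : nat).
Hypothesis F_sym : F^T = F.
Hypothesis I_cliques : enumerates_maximal_cliques F G I.
Hypothesis J_assign : constraint_assignment G I J.
Hypothesis r_ge : (r_min F G <= r)%N.

Lemma hdeg_le_r k : (hdeg_mx (G k) <= r)%N.
Proof.
apply: leq_trans r_ge; rewrite /r_min leq_max orbC.
by rewrite (leq_bigmax (F := fun k => hdeg_mx (G k))).
Qed.

Lemma deg_F_le_r : (deg_mx F <= 2 * r)%N.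
Proof.
apply: leq_trans (leq_deg_hdeg F) _; rewrite leq_mul2l /=.
by apply: leq_trans r_ge; rewrite leq_maxl.
Qed.

Lemma Lfun_dirac (S : 'X_{1..n} -> 'M[R]_p) (P : 'M[{mpoly R[n]}]_p) (x : 'rV[R]_n) (A : 'M[R]_p) :
  (forall a, S a = mon_eval x a *: A) -> Lfun S P = \tr (eval_mx P x *m A).
Proof.
move=> hS; rewrite eval_mx_coeff mulmx_suml raddf_sum; apply: eq_bigr => a _.
by rewrite hS -scalemxAl -scalemxAr.
Qed.

(* A unit eigenvector u for the smallest eigenvalue gives the feasible point
   x^alpha u u^T of the relaxation. *)
Lemma lambda_cs_le (x : 'rV[R]_n) : (0 < p)%N -> feasible G x ->
  (lambda_cs F G I J r <= (lambda_min (eval_mx F x))%:E)%E.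
Proof.
move=> p0 xfeas; have Fs := eval_mx_sym x F_sym.
have [_ [y y0 yF]] := lambda_minP p0 Fs.
pose w := (bform 1%:M y y)^-1.
have y1 : 0 < bform 1%:M y y by rewrite psd_unit_gt0 ?unitmx1 //; exact: psd1.
have w0 : 0 < w by rewrite invr_gt0.
pose S a := (w * mon_eval x a) *: (y^T *m y^T^T).
have rep a : S a = \sum_(j < 1) (w * mon_eval x a) *: (y^T *m y^T^T) by rewrite big_ord1.
have Dir a : S a = mon_eval x a *: (w *: (y^T *m y)) by rewrite /S trmxK scalerA mulrC.
have trE : \tr (y^T *m y) = bform 1%:M y y by rewrite /bform mulmx1 mxtrace_mulC trace_mx11.
apply: ereal_inf_lbound; exists S; last first.
  rewrite (Lfun_dirac _ Dir) -scalemxAr mxtraceZ mulmxA mxtrace_mulC mulmxA.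
  rewrite -[y *m eval_mx F x]mul1mx mul1mx yF -scalemxAl mxtraceZ mxtrace_mulC trE mulrCA /w.
  by rewrite mulVf ?mulr1 ?gt_eqF.
split.
- by move=> a _; rewrite /S linearZ /= trmx_mul !trmxK.
- move=> l; rewrite (moment_atomic (x := fun=> x) (w := fun=> w) (v := y^T) (fun a _ _ => rep a)).
  by apply: psd_sum => j _; apply: psdZ (psd_outer _); exact: ltW.
- move=> l k kJ; have [_ _ GI] := J_assign.
  rewrite (localizing_atomic (x := fun=> x) (w := fun=> w) (v := y^T) (GI l k kJ) (fun a _ _ => rep a)).
  by apply: psd_sum => j _; apply: psdZ (psd_conj _ (xfeas k)); exact: ltW.
by rewrite Lfun_1 Dir mon_eval0 scale1r mxtraceZ trE mulVf // gt_eqF.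
Qed.

(** [csp_clique] is a proposition, so it is made boolean classically before a maximal set is
    taken. *)
Lemma clique_in_maximal (C : {set 'I_n}) : csp_clique F G C -> exists l, C \subset I l.
Proof.
move=> hC; have [_ Imax] := I_cliques.
have [D /maxsetP[/boolp.asboolP hD Dmax] CD] :=
  @maxset_exists _ (fun D => boolp.asbool (csp_clique F G D)) C (introT (boolp.asboolP _) hC).
have /Imax[l IlD] : csp_maximal_clique F G D.
  by split=> // E hE DE; apply: Dmax => //; apply/boolp.asboolP.
by exists l; rewrite IlD.
Qed.

Lemma monomial_in_clique a : coeff_mx F a != 0 -> exists l, supp a \subset I l.
Proof. by move=> Fa; apply: clique_in_maximal => i j ia ja _; left; exists a. Qed.

Lemma coeff_deg0 s (P : 'M[{mpoly R[n]}]_s) a : deg_mx P = 0%N -> coeff_mx P a != 0 -> a = 0%MM.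
Proof.
move=> P0; apply: contra_neq_eq => a0; apply/matrixP => i j; rewrite !mxE.
apply: memN_msupp_eq0; apply: msize_mdeg_ge; apply: leq_trans (msize_deg_mx P i j) _.
by rewrite P0 lt0n mdeg_eq0.
Qed.

(** For r = 0 the matrices F and G_k are constant and the graph has no edges, so distinct maximal
    cliques cannot meet. The first moments used on overlaps need r > 0. *)
Lemma overlap_r_gt0 l l' : l != l' -> I l :&: I l' != finset.set0 -> (0 < r)%N.
Proof.
move=> ll' /set0Pn[i]; rewrite finset.in_setI => /andP[il il'].
rewrite lt0n; apply/eqP => r0.
have deg0 (s : nat) (P : 'M[{mpoly R[n]}]_s) : (hdeg_mx P <= r)%N -> deg_mx P = 0%N.
  by rewrite r0; have := leq_deg_hdeg P; move: (hdeg_mx _) (deg_mx _); lia.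
have Fdeg : deg_mx F = 0%N by have := deg_F_le_r; rewrite r0; lia.
have nadj j k : ~ csp_adj F G j k.
  move=> [[a [/(coeff_deg0 Fdeg) -> ]]|[s [[a /coeff_deg0 h ia] _]]].
    by rewrite supp0 inE.
  by move: ia; rewrite h ?supp0 ?inE // deg0 // hdeg_le_r.
have [Iinj Imax] := I_cliques.
have sing l0 : i \in I l0 -> I l0 = [set i].
  move=> il0; have [hc _] : csp_maximal_clique F G (I l0) by apply/Imax; exists l0.
  apply/finset.setP => j; rewrite inE; apply/idP/eqP => [jl|->//].
  by apply/eqP; apply: contraT => ji; case: (nadj _ _ (hc _ _ jl il0 ji)).
by move/negP: ll'; apply; apply/eqP/Iinj; rewrite (sing l) // (sing l').
Qed.

(** Assigns each monomial to one clique, which splits F into a sum of F_l; [None] arises only for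
    monomials absent from F. *)
Definition clique_of (a : 'X_{1..n}) : option 'I_t := [pick l | supp a \subset I l].

Lemma sum_by_clique d (g : 'X_{1..n} -> R) :
  (forall a, coeff_mx F a = 0 -> g a = 0) ->
  \sum_(a : 'X_{1..n < d}) g a =
  \sum_l \sum_(a : 'X_{1..n < d} | clique_of a == Some l) g a.
Proof.
move=> g0; rewrite (exchange_big_dep predT) //=; apply: eq_bigr => a _.
have [/g0 ->|Fa] := eqVneq (coeff_mx F a) 0; first by rewrite big1.
rewrite /clique_of; case: pickP => [l _|h].
  by rewrite (big_pred1 l) // => l' /=; rewrite (inj_eq (@Some_inj _)) eq_sym.
by have [l] := monomial_in_clique Fa; rewrite h.
Qed.

Lemma clique_of_supp a l : clique_of a == Some l -> supp a \subset I l.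
Proof. by rewrite /clique_of; case: pickP => // l' h /eqP[<-]. Qed.

(** * Patched points and their optimality *)

Section Optimality.
Variables (S : 'X_{1..n} -> 'M[R]_p) (N : 'I_t -> nat).
Variables (x : forall l, 'I_(N l) -> rpoint R (I l)) (v : 'cV[R]_p).
Arguments x : clear implicits.
Hypothesis S_opt : cs_optimal F G I J r S.
Hypothesis x_extr : forall l, extracted G (J l) r S (x l).
Hypotheses (S0 : S 0%MM = v *m v^T) (v1 : \sum_k v k 0 ^+ 2 = 1).
Hypothesis overlap : forall i j : 'I_t, i != j -> I i :&: I j != finset.set0 ->
  \rank (moment_mx r S (I i :&: I j)) = 1%N.

Definition patched (z : 'rV[R]_n) := forall l, exists i, restrict (I l) z = x l i.

Lemma patched_feasible z : patched z -> feasible G z.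
Proof.
move=> hz k; have [_ Jcover GI] := J_assign.
have /bigcupP[l _ kJ] : k \in \bigcup_l J l by rewrite Jcover inE.
have [i zi] := hz l; have [_ /(_ i k kJ) h _] := x_extr l.
rewrite (eval_mx_agree (y := extend0 (x l i)) (GI l k kJ)) // => a al.
by rewrite -zi extend0_restrict.
Qed.

Lemma patch (c : forall l, 'I_(N l)) :
  exists z, forall l, restrict (I l) z = x l (c l).
Proof.
(* Each coordinate is read from some clique containing it; 0 is a default. *)
pose z : 'rV[R]_n := \row_a (oapp (fun l => extend0 (x l (c l)) 0 a) 0 [pick l | a \in I l]).
exists z => l; apply/restrict_eq => a al; rewrite mxE.
case: pickP => [l' al'|/(_ l)] /=; last by rewrite al.
have [-> //|ll'] := eqVneq l' l.
have ov : I l' :&: I l != finset.set0.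
  by apply/set0Pn; exists a; rewrite finset.in_setI al al'.
have r0 := overlap_r_gt0 ll' ov; have rk := overlap ll' ov.
have aI : a \in I l' :&: I l by rewrite finset.in_setI al al'.
have [w [w0 w1 rep]] := extracted_weights (x_extr l) S0 v1.
have [w' [w0' w1' rep']] := extracted_weights (x_extr l') S0 v1.
(* Either clique puts its coordinate a at the value determined by the moment [S U_(a)%MM]; as v v^T
   has trace 1, the two values agree. *)
have E := rank1_marginal rep w0 w1 v1 r0 aI (finset.subsetIr _ _) rk (c l).
have E' := rank1_marginal rep' w0' w1' v1 r0 aI (finset.subsetIl _ _) rk (c l').
have := congr1 mxtrace (etrans E' (esym E)).
by rewrite !mxtraceZ trace_outer v1 !mulr1.
Qed.

(** [FV a] is v^T F_a v, and [f l] is the function v^T F_l v for the part F_l of F assigned to the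
    clique l. *)
Let FV a := \tr (coeff_mx F a *m (v *m v^T)).
Let f l (z : 'rV[R]_n) :=
  \sum_(a : 'X_{1..n < (deg_mx F).+1} | clique_of a == Some l) mon_eval z a * FV a.

Lemma FV0 a : coeff_mx F a = 0 -> FV a = 0.
Proof. by rewrite /FV => ->; rewrite mul0mx mxtrace0. Qed.

Lemma rayleigh z : bform (eval_mx F z) v^T v^T = \sum_l f l z.
Proof.
rewrite -(sum_by_clique (deg_mx F).+1 (g := fun a => mon_eval z a * FV a)); last first.
  by move=> a /FV0 ->; rewrite mulr0.
rewrite /bform -trace_mx11 trmxK -mulmxA mxtrace_mulC -mulmxA eval_mx_coeff mulmx_suml.
rewrite raddf_sum; apply: eq_bigr => a _.
by rewrite /= -scalemxAl mxtraceZ.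
Qed.

Lemma f_restrict l z y : restrict (I l) z = y -> f l z = f l (extend0 y).
Proof.
move=> /restrict_eq h; apply: eq_bigr => a al.
by rewrite (mon_eval_agree (clique_of_supp al) h).
Qed.

(** The moments of the monomials in F_l come from the measure of the clique l, as deg F is at most
    2r. *)
Lemma Lfun_atoms (w : forall l, 'I_(N l) -> R) :
  (forall l, atomic_rep S (I l) r v (fun j => extend0 (x l j)) (w l)) ->
  Lfun S F = \sum_l \sum_i w l i * f l (extend0 (x l i)).
Proof.
move=> rep; rewrite /Lfun (sum_by_clique _ (g := fun a => \tr (coeff_mx F a *m S a))); last first.
  by move=> a ->; rewrite mul0mx mxtrace0.
apply: eq_bigr => l _.
under [RHS]eq_bigr => i _ do rewrite mulr_sumr.
rewrite [RHS]exchange_big; apply: eq_bigr => a al /=.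
rewrite (rep l) ?clique_of_supp //; last first.
  by apply: leq_trans deg_F_le_r; rewrite -ltnS bmdeg.
rewrite mulmx_sumr raddf_sum; apply: eq_bigr => i _.
by rewrite /= -scalemxAr mxtraceZ mulrA.
Qed.

(** For the patch z0 of minimizing atoms, L_S(F) <= lambda_star <= v^T F(z0) v <= L_S(F). Since the
    weights are positive, equality makes every atom a minimizer of its f_l, so all patched points
    share this value. *)
Lemma relaxation_exact : (0 < p)%N ->
  (Lfun S F)%:E = lambda_star F G /\
  forall z, patched z -> bform (eval_mx F z) v^T v^T = Lfun S F.
Proof.
move=> p0.
have v1' : bform 1%:M v^T v^T = 1 by rewrite bform1_outer v1.
have le_star z : feasible G z -> (lambda_star F G <= (bform (eval_mx F z) v^T v^T)%:E)%E.
  move=> hz; apply: (@le_trans _ _ (lambda_min (eval_mx F z))%:E).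
    by apply: ereal_inf_lbound; exists z.
  have [/(psd_ge0 v^T) h _] := lambda_minP p0 (eval_mx_sym z F_sym).
  move: h; rewrite -scalemx1 -scaleNr bform_mx v1' mulr1 lee_fin.
  by rewrite subr_ge0.
have star_ge : ((Lfun S F)%:E <= lambda_star F G)%E.
  case: S_opt => _ ->; apply: le_ereal_inf_tmp => _ [z hz <-].
  exact: lambda_cs_le.
have /fin_all_exists[w hw] : forall l, exists w : 'I_(N l) -> R,
    [/\ forall j, 0 < w j, \sum_j w j = 1 &
      atomic_rep S (I l) r v (fun j => extend0 (x l j)) w].
  by move=> l; exact: extracted_weights.
have LE := Lfun_atoms (fun l => let: And3 _ _ rep := hw l in rep).
(* Each clique has an atom because its weights sum to 1, so a minimum exists. *)
have /fin_all_exists[c hc] : forall l, exists c : 'I_(N l),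
    forall i, f l (extend0 (x l c)) <= f l (extend0 (x l i)).
  move=> l; have [_ wl _] := hw l.
  case: (N l) (x l) (w l) wl => [|N'] xl wl.
    by rewrite big_ord0 => /eqP; rewrite eq_sym oner_eq0.
  move=> _; have [i _ h] := Order.TotalTheory.arg_minP (fun i => f l (extend0 (xl i))) (isT : predT ord0).
  by exists i => j; exact: h.
pose mn l := f l (extend0 (x l (c l))).
have [z0 hz0] := patch c.
have z0mn : bform (eval_mx F z0) v^T v^T = \sum_l mn l.
  by rewrite rayleigh; apply: eq_bigr => l _; exact: f_restrict.
(* The gap is a sum of nonnegative terms, one per atom: this gives the bound and, once the gap
   vanishes, the minimality of every atom. *)
have Lmn : Lfun S F - \sum_l mn l = \sum_l \sum_i w l i * (f l (extend0 (x l i)) - mn l).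
  rewrite LE -sumrB; apply: eq_bigr => l _; have [_ wl _] := hw l.
  under [RHS]eq_bigr => i _ do rewrite mulrBr.
  by rewrite sumrB -mulr_suml wl mul1r.
have term_ge0 l i : 0 <= w l i * (f l (extend0 (x l i)) - mn l).
  by have [wl _ _] := hw l; rewrite mulr_ge0 ?subr_ge0 ?(ltW (wl i)) // hc.
have mn_le : \sum_l mn l <= Lfun S F.
  by rewrite -subr_ge0 Lmn sumr_ge0 // => l _; rewrite sumr_ge0.
have star_mn : (lambda_star F G <= (\sum_l mn l)%:E)%E.
  rewrite -z0mn; apply: le_star; apply: patched_feasible => l.
  by exists (c l).
have Lstar : (Lfun S F)%:E = lambda_star F G.
  apply: le_anti; rewrite star_ge /=; apply: le_trans star_mn _.
  by rewrite lee_fin.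
have mnE : \sum_l mn l = Lfun S F.
  by apply: le_anti; rewrite mn_le -lee_fin Lstar.
split=> // z hz; rewrite rayleigh -mnE; apply: eq_bigr => l _.
have [i /f_restrict ->] := hz l; apply/eqP; rewrite -subr_eq0.
move/eqP: Lmn; rewrite mnE subrr eq_sym psumr_eq0 => [|l' _]; last by rewrite sumr_ge0.
move=> /allP/(_ l (mem_index_enum _))/=; rewrite psumr_eq0 //.
move=> /allP/(_ i (mem_index_enum _))/=; rewrite mulf_eq0 gt_eqF //=.
by have [wl _ _] := hw l.
Qed.

(** The unit vector v attains the smallest eigenvalue as its Rayleigh quotient, so it lies in the
    kernel of the psd matrix F(z) - lambda_min(F(z)) I. *)
Lemma patched_optimal z : (0 < p)%N -> patched z ->
  optimal_solution F G z /\ eval_mx F z *m v = fine (lambda_star F G) *: v.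
Proof.
move=> p0 hz; have [Lstar /(_ z hz) zL] := relaxation_exact p0.
have v1' : bform 1%:M v^T v^T = 1 by rewrite bform1_outer v1.
have zf := patched_feasible hz.
have [hpsd _] := lambda_minP p0 (eval_mx_sym z F_sym).
have bE : bform (eval_mx F z - (lambda_min (eval_mx F z))%:M) v^T v^T =
    Lfun S F - lambda_min (eval_mx F z).
  by rewrite -scalemx1 -scaleNr bform_mx v1' mulr1 zL.
have lE : lambda_min (eval_mx F z) = Lfun S F.
  apply: le_anti; rewrite -subr_ge0 -bE psd_ge0 //= -lee_fin Lstar.
  by apply: ereal_inf_lbound; exists z.
split; first by split=> //; rewrite lE.
rewrite -Lstar /= -lE; apply: trmx_inj; rewrite trmx_mul (eval_mx_sym z F_sym) linearZ /=.
by apply/eqP; rewrite -subr_eq0 -mul_mx_scalar -mulmxBr (psd_kernel hpsd) // bE lE subrr.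
Qed.

End Optimality.
End Relaxation.

Theorem corollary5p3 (R : realType) (n p m t : nat) (q : 'I_m -> nat)
    (F : 'M[{mpoly R[n]}]_p) (G : forall k : 'I_m, 'M[{mpoly R[n]}]_(q k))
    (I : 'I_t -> {set 'I_n}) (J : 'I_t -> {set 'I_m})
    (r : nat) (S : 'X_{1..n} -> 'M[R]_p)
    (F_sym : F^T = F)
    (G_sym : forall k, (G k)^T = G k)
    (I_cliques : enumerates_maximal_cliques F G I)
    (J_assign : constraint_assignment G I J)
    (r_ge : (r_min F G <= r)%N)
    (S_opt : cs_optimal F G I J r S)
    (rank_S0 : \rank (S 0%MM) = 1%N)
    (flat : forall l : 'I_t,
       \rank (moment_mx r S (I l)) = \rank (moment_mx (r - dK G (J l)) S (I l)))
    (overlap : forall i j : 'I_t, i != j -> I i :&: I j != finset.set0 ->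
       \rank (moment_mx r S (I i :&: I j)) = 1%N) :
  [/\ lambda_cs F G I J r = lambda_star F G,
      forall l : 'I_t,
        exists x : 'I_(\rank (moment_mx r S (I l))) -> rpoint R (I l),
          extracted G (J l) r S x
    & forall (x : forall l : 'I_t,
                'I_(\rank (moment_mx r S (I l))) -> rpoint R (I l))
             (v : 'cV[R]_p),
        (forall l, extracted G (J l) r S (x l)) ->
        S 0%MM = v *m v^T ->
        forall xhat : 'rV[R]_n,
          (forall l, exists i, restrict (I l) xhat = x l i) ->
          [/\ optimal_solution F G xhat,
              v != 0
            & eval_mx F xhat *m v = fine (lambda_star F G) *: v]].
Proof.
have [[S_sym M_psd L_psd S1] S_val] := S_opt.
have [_ _ GI] := J_assign.
have p0 : (0 < p)%N by apply: leq_trans (rank_leq_row (S 0%MM)); rewrite rank_S0.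
(* L_S(I_p) = 1 reads tr S_0 = 1, which makes v a unit vector. *)
have norm1 (v : 'cV[R]_p) : S 0%MM = v *m v^T -> \sum_k v k 0 ^+ 2 = 1.
  by move=> S0; rewrite -trace_outer -S0 -Lfun_1.
(* The empty set is a clique, so at least one maximal clique exists, and its moment matrix shows S_0
   to be psd. *)
have [l0 _] : exists l, (finset.set0 : {set 'I_n}) \subset I l.
  by apply: clique_in_maximal I_cliques _ _ => i j; rewrite inE.
have [v0 S0] := rank1_psd (moment_mx_S0_psd (M_psd l0)) rank_S0.
have extr l : exists x : 'I_(\rank (moment_mx r S (I l))) -> rpoint R (I l),
    extracted G (J l) r S x.
  apply: extraction_exists (flat l) S0 (norm1 _ S0) => // [k _|k|k].
  - exact: (hdeg_le_r r_ge).
  - exact: GI.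
  - exact: L_psd.
split=> // [|x v hx Sv xhat hxhat].
  (* The equality of the optimal values mentions no points; any extraction serves to derive it. *)
  have [x hx] := fin_all_exists extr.
  have [<- _] := relaxation_exact F_sym I_cliques J_assign r_ge S_opt hx S0 (norm1 _ S0) overlap p0.
  by rewrite S_val.
have [opt ev] := patched_optimal F_sym I_cliques J_assign r_ge S_opt hx Sv (norm1 _ Sv) overlap p0 hxhat.
split=> //; apply/eqP => v_eq0.
by have := rank_S0; rewrite Sv v_eq0 mul0mx mxrank0.
Qed.
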